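(* Let $\mathcal F$ be a function space with seminorm $|\cdot|_{\mathcal F}$ such that $\mathcal F \subset C([0,1]^d)$ and, for some $\beta\in(0,2)$ and some $D>0$, $H_\infty(\delta, B_{\mathcal F}) \le D\delta^{-\beta}$ for every $\delta>0$. Let $\alpha > 2\beta/(\beta+2)$, let $a>0$ be a constant, put $h = a\, n^{-1/(2+\beta)}$, and let $\bar f_\lambda$, $\lambda=(h,\mathcal F)$, be a penalized empirical risk minimizer, i.e. a minimizer over $f \in \mathcal F$ of $$\frac1n\sum_{i=1}^n (Y_i-f(X_i))^2 + h^2 |f|_{\mathcal F}^\alpha .$$ If $f_0\in\mathcal F$, then $$E_n \|\bar f_\lambda - f_0\|_n^2 \le C_1 (1+|f_0|_{\mathcal F}^\alpha)\, n^{-2/(2+\beta)}$$ for $n$ large enough, where $C_1$ is a fixed constant depending on $a,\beta,\alpha$ and $b$. If moreover $\|\bar f_\lambda - f_0\|_\infty \le Q$ almost surely for some constant $Q>0$, then $$E^n \|\bar f_\lambda - f_0\|^2 \le C_2 (1+|f_0|_{\mathcal F}^\alpha)\, n^{-2/(2+\beta)}$$ for $n$ large enough, where $C_2$ is a fixed constant depending on $C_1$ and $Q$.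
   Context: Regression model: $(X,Y),(X_1,Y_1),\dots,(X_n,Y_n)$ are i.i.d. in $\mathbb R^d\times\mathbb R$ with $Y=f_0(X)+\sigma\varepsilon$ (so $Y_i = f_0(X_i)+\sigma\varepsilon_i$), where $f_0:\mathbb R^d\to\mathbb R$, the noise level $\sigma>0$ is known, and $X$ takes values in $[0,1]^d$; its law $P_X$ is otherwise arbitrary (it may be discrete). Conditionally on $X$, the noise $\varepsilon$ is symmetric and subgaussian: there is $b_\varepsilon>0$ with $E[\exp(t\varepsilon)\mid X]\le \exp(b_\varepsilon^2t^2/2)$ for all $t>0$. Put $b:=\sigma b_\varepsilon$. Notation: $D_n=[(X_i,Y_i):1\le i\le n]$ is the sample; $E^n$ is expectation with respect to its joint law $P^n$, and $E_n$ is expectation with respect to $P_n:=P^n[\cdot\mid X^n]$, the conditional law of $D_n$ given the design $X^n=(X_1,\dots,X_n)$. $\|f\|_n^2:=n^{-1}\sum_{i=1}^n f(X_i)^2$, $\|f\|^2:=\int f(x)^2P_X(dx)$, $\|f\|_\infty:=\sup_{x\in[0,1]^d}|f(x)|$. $C([0,1]^d)$ is the set of continuous functions on $[0,1]^d$. $B_{\mathcal F}:=\{f\in\mathcal F:|f|_{\mathcal F}\le1\}$. For a set $A$ of functions, $H_\infty(\delta,A):=\log N(\delta,A,\|\cdot\|_\infty)$, where $N(\delta,A,\|\cdot\|_\infty)$ is the minimal number of $\|\cdot\|_\infty$-balls of radius $\delta$ needed to cover $A$. It is assumed throughout that a penalized empirical risk minimizer exists; it need not be unique.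
   Formalization: The constant C_1 (and hence C_2) may also depend on the entropy constant D, which the English does not list; without this the claim fails, since rescaling the seminorm makes the risk constant unbounded. *)

(* Defs.v *)
From HB Require Import structures.
From mathcomp Require Import all_boot all_order all_algebra.
From mathcomp Require Import finmap.
From mathcomp Require Import all_classical all_reals all_analysis.
From mathcomp Require Import measurable_realfun.

Set Implicit Arguments.
Unset Strict Implicit.
Unset Printing Implicit Defensive.

Import Order.TTheory GRing.Theory Num.Theory.
Import numFieldNormedType.Exports.

Local Open Scope classical_set_scope.
Local Open Scope ring_scope.

(* Matrices, hence R^d = 'rV[R]_d, carry their Borel sigma-algebra. *)
HB.instance Definition _ (R : realType) (m n : nat) :=
  @isMeasurable.Build (sigma_display (@open 'M[R]_(m, n))) 'M[R]_(m, n)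
    <<s @open 'M[R]_(m, n) >> (@sigma_algebra0 _ setT _) (@sigma_algebraC _ _)
    (@sigma_algebra_bigcup _ setT _).

Section function_spaces.
Context {R : realType} {d : nat}.
Implicit Types (f g : 'rV[R]_d -> R) (F A : set ('rV[R]_d -> R)).

Definition cube : set 'rV[R]_d := [set x | forall i, 0 <= x ord0 i <= 1].

Local Open Scope ereal_scope.

Definition sup_norm f : \bar R := ereal_sup [set `|f x|%:E | x in cube].

Local Close Scope ereal_scope.

(* A space F of continuous functions on the cube with a seminorm. A function
   on the cube is represented by all its extensions to R^d, so that membership
   in F and the seminorm only depend on the restriction to the cube. *)
Record seminormed_function_space F (sn : ('rV[R]_d -> R) -> R) : Prop := {
  fspace_restriction : forall f g,
    F f -> (forall x, cube x -> f x = g x) -> F g /\ sn g = sn f;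
  fspace_continuous : forall f, F f -> {within cube, continuous f};
  fspace0 : F (cst 0);
  fspaceD : forall f g, F f -> F g -> F (f \+ g);
  fspaceZ : forall (c : R) f, F f -> F (fun x => c * f x);
  seminorm_ge0 : forall f, F f -> 0 <= sn f;
  seminormD : forall f g, F f -> F g -> sn (f \+ g) <= sn f + sn g;
  seminormZ : forall (c : R) f, F f -> sn (fun x => c * f x) = `|c| * sn f
}.

Definition unit_ball F (sn : ('rV[R]_d -> R) -> R) : set ('rV[R]_d -> R) :=
  [set f | F f /\ sn f <= 1].

Local Open Scope ereal_scope.

(* The balls are closed, with centres anywhere in C([0,1]^d). *)
Definition covered_by (delta : R) A (k : nat) : Prop :=
  exists c : 'I_k -> 'rV[R]_d -> R,
    (forall j, {within cube, continuous (c j)}) /\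
    forall f, A f -> exists j, sup_norm (f \- c j)%R <= delta%:E.

(* +oo when no finite cover exists. *)
Definition covering_number (delta : R) A : \bar R :=
  ereal_inf [set k%:R%:E | k in covered_by delta A].

Definition sup_entropy (delta : R) A : \bar R := lne (covering_number delta A).

End function_spaces.

Arguments cube {R} d.

Section conditional_expectation.
Context {R : realType} {dO dT : measure_display}.
Context {Omega : measurableType dO} {T : measurableType dT}.
Variable P : probability Omega R.

Local Open Scope ereal_scope.

Definition cond_expectation_version (V : Omega -> T) (Z : Omega -> \bar R)
    (phi : T -> \bar R) : Prop :=
  [/\ measurable_fun setT phi, (forall v, 0 <= phi v) &
    forall B, measurable B ->
      \int[P]_(w in V @^-1` B) phi (V w) = \int[P]_(w in V @^-1` B) Z w].

(* For measurable V and nonnegative measurable Z, the value v |-> E[Z | V = v],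
   so that E[Z | V] is cond_expectation V Z \o V. A version always exists in
   this case and is unique up to a null set for the law of V, so the default
   value +oo is never used. *)
Definition cond_expectation (V : Omega -> T) (Z : Omega -> \bar R) :
    T -> \bar R :=
  xget (cst +oo) [set phi | cond_expectation_version V Z phi].

End conditional_expectation.

Section iid.
Context {R : realType} {dO dT : measure_display}.
Context {Omega : measurableType dO} {T : measurableType dT}.
Variable P : probability Omega R.

Local Open Scope ereal_scope.

Definition independent_family (Z : nat -> Omega -> T) : Prop :=
  forall (J : {fset nat}) (A : nat -> set T), (forall i, measurable (A i)) ->
    P (\bigcap_(i in [set` J]) (Z i @^-1` A i)) =
    \prod_(i <- J) P (Z i @^-1` A i).

Definition identically_distributed (Z : nat -> Omega -> T) : Prop :=
  forall i j (A : set T), measurable A -> P (Z i @^-1` A) = P (Z j @^-1` A).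

End iid.

Section regression.
Context {R : realType} {d : nat} {dO : measure_display}.
Context {Omega : measurableType dO}.
Variable P : probability Omega R.

(* The observations are (X i, Y i), i = 0, 1, 2, ...; a sample of size n
   consists of those with i < n, and P_X is the law of X 0. *)
Record regression_model (f0 : 'rV[R]_d -> R) (sigma b_eps : R)
    (X : nat -> {RV P >-> 'rV[R]_d}) (Y eps : nat -> {RV P >-> R}) : Prop := {
  model_sigma_gt0 : 0 < sigma;
  model_b_eps_gt0 : 0 < b_eps;
  model_cube : forall i w, cube d (X i w);
  model_Y : forall i w, Y i w = f0 (X i w) + sigma * eps i w;
  model_indep : independent_family P (fun i w => (X i w, Y i w));
  model_ident : identically_distributed P (fun i w => (X i w, Y i w));
  model_symmetric : forall i (B : set R), measurable B ->
    {ae P, forall w,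
      cond_expectation P (X i)
        (fun w' => (\1_(eps i @^-1` B) w')%:E) (X i w) =
      cond_expectation P (X i)
        (fun w' => (\1_((fun u => - eps i u) @^-1` B) w')%:E) (X i w)};
  model_subgaussian : forall i t, 0 < t ->
    {ae P, forall w,
      (cond_expectation P (X i) (fun w' => (expR (t * eps i w'))%:E) (X i w)
        <= (expR (b_eps ^+ 2 * t ^+ 2 / 2))%:E)%E}
}.

Definition design (X : nat -> {RV P >-> 'rV[R]_d}) (n : nat) (w : Omega) :
    n.-tuple 'rV[R]_d :=
  [tuple X (val i) w | i < n].

Definition sample (X : nat -> {RV P >-> 'rV[R]_d}) (Y : nat -> {RV P >-> R})
    (n : nat) (w : Omega) : n.-tuple ('rV[R]_d * R) :=
  [tuple (X (val i) w, Y (val i) w) | i < n].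

End regression.

Section estimation.
Context {R : realType} {d : nat}.
Implicit Types f : 'rV[R]_d -> R.

Definition empirical_norm2 (n : nat) (x : n.-tuple 'rV[R]_d) f : R :=
  n%:R^-1 * \sum_(i < n) f (tnth x i) ^+ 2.

(* The law Q of the covariate lives on the cube, off which f is irrelevant. *)
Definition L2_norm2 (Q : probability 'rV[R]_d R) f : \bar R :=
  (\int[Q]_(x in cube d) (f x ^+ 2)%:E)%E.

Definition penalized_risk (n : nat) (h alpha : R)
    (sn : ('rV[R]_d -> R) -> R) (D : n.-tuple ('rV[R]_d * R)) f : R :=
  n%:R^-1 * \sum_(i < n) ((tnth D i).2 - f (tnth D i).1) ^+ 2
  + h ^+ 2 * (sn f `^ alpha).

Definition penalized_erm (n : nat) (h alpha : R) (F : set ('rV[R]_d -> R))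
    (sn : ('rV[R]_d -> R) -> R) (D : n.-tuple ('rV[R]_d * R)) f : Prop :=
  F f /\ forall g, F g ->
    penalized_risk h alpha sn D f <= penalized_risk h alpha sn D g.

(* Measurable dependence on the sample, without which the expected risk of an
   estimator is meaningless. *)
Definition measurable_estimator (n : nat)
    (fbar : n.-tuple ('rV[R]_d * R) -> 'rV[R]_d -> R) : Prop :=
  forall x, cube d x -> measurable_fun setT (fun D => fbar D x).

End estimation.

(* Main.v *)
(** Let g = fbar - f_0 and <g> = n^(-1/2) sum_i sigma eps_i g(X_i). Minimality
    of fbar gives the basic inequality
      |g|_n^2 + h^2 |fbar|^alpha <= 2 n^(-1/2) <g> + h^2 |f_0|^alpha.
    For fixed u, exp(lam <u> - lam^2 b^2 |u|_n^2 / 2) has conditional mean at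
    most 1 given the design. Instead of a union bound, these exponentials are
    averaged over the centres, and the increments between centres, of sup-norm
    covers of the unit ball at all dyadic scales: the average W still has
    conditional mean at most 1 and controls all the <u> at once. Chaining
    bounds <g> by |g|_n^(1 - beta/2) (|fbar| + |f_0| + 1)^(beta/2) times an
    affine function of ln(1 + W), and alpha > 2 beta / (beta + 2) is exactly
    what makes beta / (2 alpha) + (2 - beta) / 4 < 1, so that the basic
    inequality solves to
      |g|_n^2 + h^2 (|fbar| + |f_0| + 1)^alpha
        <= C n^(-2/(2 + beta)) (1 + |f_0|^alpha + W).
    Integrating over design events yields the conditional bound.

    For the population norm the same averaging is applied to the variables
    exp(n m / (2 Q^2) - sum_i u(X_i)^2 / Q^2), m = E u(X)^2, which have mean at
    most 1 when |u| <= Q. Here u ranges over centres clipped at Q, for the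
    balls of seminorm radius J = 2^j, with a sup-norm resolution whose square
    is J^(2 beta / (beta + 2)) n^(-2/(2 + beta)); this is dominated by
    J^alpha n^(-2/(2 + beta)), which the oracle inequality controls. *)

Require Import Defs.
From HB Require Import structures.
From mathcomp Require Import all_boot all_order all_algebra.
From mathcomp Require Import finmap.
From mathcomp Require Import all_classical all_reals all_analysis.
From mathcomp Require Import measurable_realfun.
From mathcomp Require Import ring lra.

Import Order.TTheory GRing.Theory Num.Theory.
Import numFieldNormedType.Exports.

Local Open Scope classical_set_scope.
Local Open Scope ring_scope.

(** * Integrals over preimages *)

(** Both averages are countable sums of measurable terms, fixed before any estimator appears, and
    the inequalities involving them hold at every outcome. Chaining and the solution of the basic
    inequality are therefore deterministic, and probability enters only through the mean of [W].
    Statements given the design are carried as integrals over events of the form {design in B}. Only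
    a first moment of W is available, while chaining produces powers of ln(1 + W); each such power
    is at most a constant times 1 + W. Extracting one term from the average costs the logarithm of
    its inverse weight. At scale delta this is at most a constant times delta^(-beta), the order of
    the entropy itself, so all scales can be kept at once. The choice lam = delta^(-(1 + beta/2))
    gives the variance term the same order, and division by lam leaves delta^(1 - beta/2), which
    sums geometrically over dyadic scales because beta < 2. For the population norm the seminorm of
    the estimator is random with no a priori bound, which is why balls of every dyadic radius enter
    a single average. *)

Section density_measure.
Context {R : realType} {dO dT : measure_display}.
Context {Omega : measurableType dO} {T : measurableType dT}.
Variables (mu : {measure set Omega -> \bar R}) (h : Omega -> R).
Variable V : Omega -> T.
Hypotheses (mh : measurable_fun setT h) (h0 : forall w, 0 <= h w).
Hypothesis mV : measurable_fun setT V.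

Local Open Scope ereal_scope.

(** The image under V of the measure with density h. The hypotheses are arguments of the definition
    so that the measure structure can be inferred from the term itself. *)
Definition density_measure of measurable_fun setT h & (forall w, 0 <= h w)%R
    & measurable_fun setT V := fun A : set T => \int[mu]_(w in V @^-1` A) (h w)%:E.

Local Notation nu := (density_measure mh h0 mV).

Let nu0 : nu set0 = 0.
Proof. by rewrite /density_measure preimage_set0 integral_set0. Qed.

Let nu_ge0 A : 0 <= nu A.
Proof. by apply: integral_ge0 => w _; rewrite lee_fin. Qed.

Let measurable_preimage A : measurable A -> measurable (V @^-1` A).
Proof. by move=> mA; rewrite -[X in measurable X]setTI; exact: mV. Qed.

Let mEh D : measurable_fun D (fun w => (h w)%:E).
Proof. by apply: (measurable_funS measurableT) => //; exact/measurable_EFinP. Qed.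

Let nu_semi_sigma_additive : semi_sigma_additive nu.
Proof.
move=> F mF tF mUF.
rewrite /density_measure preimage_bigcup ge0_integral_bigcup//=.
- apply: is_cvg_nneseries => n _ _.
  by apply: integral_ge0 => w _; rewrite lee_fin.
- by move=> k; exact: measurable_preimage.
- by move=> w _; rewrite lee_fin.
- apply/trivIsetP => i j _ _ ij; rewrite -preimage_setI.
  by move/trivIsetP : tF => /(_ i j I I ij) ->; rewrite preimage_set0.
Qed.

HB.instance Definition _ := isMeasure.Build _ _ _ nu
  nu0 nu_ge0 nu_semi_sigma_additive.

Import HBNNSimple.

Lemma integral_density_measure (phi : T -> \bar R) :
  measurable_fun setT phi -> (forall v, 0 <= phi v) ->
  \int[nu]_v phi v = \int[mu]_w ((h w)%:E * phi (V w)).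
Proof.
move=> mphi phi0; pose s := nnsfun_approx measurableT mphi.
have mhs n : measurable_fun setT (fun w => (h w)%:E * (s n (V w))%:E).
  apply: emeasurable_funM => //; apply/measurable_EFinP.
  by apply: measurableT_comp.
have nds v : {homo (fun n => (s n v)%:E) : n m / (n <= m)%N >-> n <= m}.
  by move=> n m nm; rewrite lee_fin; exact/lefP/nd_nnsfun_approx.
have cs v : EFin \o s^~ v @ \oo --> phi v.
  exact: (cvg_nnsfun_approx measurableT mphi (fun v _ => phi0 v)).
transitivity (limn (fun n => \int[nu]_v (s n v)%:E)).
  rewrite -monotone_convergence//=.
  - by apply: eq_integral => v _; apply/esym/cvg_lim => //; exact: cs.
  - by move=> n; apply/measurable_EFinP.
  - by move=> n v _; rewrite lee_fin.
transitivity (limn (fun n => \int[mu]_w ((h w)%:E * (s n (V w))%:E))); last first.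
  rewrite -monotone_convergence//=.
  - apply: eq_integral => w _; apply/cvg_lim => //.
    by apply: cvgeZl => //; exact: cs.
  - by move=> n w _; rewrite mule_ge0// lee_fin.
  - by move=> w _ n m nm; rewrite lee_wpmul2l ?lee_fin// -lee_fin nds.
congr (limn _); apply/funext => n.
transitivity (\int[nu]_v
    (\sum_(y \in range (s n)) (y * \1_(s n @^-1` [set y]) v)%:E)).
  by apply: eq_integral => v _; rewrite fsumEFin// -fimfunE.
rewrite ge0_integral_fsum//; last 2 first.
- by move=> y; apply/measurable_EFinP; exact: measurable_funM.
- by move=> m y _; exact: nnfun_muleindic_ge0.
transitivity (\int[mu]_w (\sum_(y \in range (s n))
    (h w)%:E * (y * \1_(s n @^-1` [set y]) (V w))%:E)); last first.
  apply: eq_integral => w _; rewrite -ge0_mule_fsumr.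
    by rewrite fsumEFin// -fimfunE.
  by move=> y; exact: nnfun_muleindic_ge0.
have mind y : measurable_fun setT (fun w => \1_(s n @^-1` [set y]) (V w) : R).
  by apply: measurableT_comp => //; exact: measurable_indic.
rewrite ge0_integral_fsum//; last 2 first.
- by move=> y; apply: emeasurable_funM => //; apply/measurable_EFinP/measurable_funM.
- by move=> y w _; apply: mule_ge0; rewrite ?lee_fin//; exact: nnfun_muleindic_ge0.
apply: eq_fsbigr => y; rewrite inE => -[v _ yE].
have y0 : (0 <= y)%R by rewrite -yE.
under eq_integral do rewrite EFinM.
rewrite integralZl_indic_nnsfun// integral_indic// setIT.
under eq_integral do rewrite EFinM muleCA.
rewrite ge0_integralZl//; last 2 first.
- by apply: emeasurable_funM => //; exact/measurable_EFinP.
- by move=> w _; apply: mule_ge0; rewrite lee_fin.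
congr (_ * _); rewrite [LHS]integral_mkcond; apply: eq_integral => w _.
by rewrite epatch_indic.
Qed.

End density_measure.

Section density_comparison.
Context {R : realType} {dO dT : measure_display}.
Context {Omega : measurableType dO} {T : measurableType dT}.
Variable mu : {measure set Omega -> \bar R}.
Variables (h k : Omega -> R) (V : Omega -> T).
Hypotheses (mh : measurable_fun setT h) (h0 : forall w, 0 <= h w).
Hypotheses (mk : measurable_fun setT k) (k0 : forall w, 0 <= k w).
Hypothesis mV : measurable_fun setT V.

Local Open Scope ereal_scope.

(** An inequality on the events V^-1(A) compares two measures on T, hence all nonnegative integrands
    that are functions of V. *)
Lemma le_integral_density (phi : T -> \bar R) :
  (forall A, measurable A ->
    \int[mu]_(w in V @^-1` A) (h w)%:E <= \int[mu]_(w in V @^-1` A) (k w)%:E) ->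
  measurable_fun setT phi -> (forall v, 0 <= phi v) ->
  \int[mu]_w ((h w)%:E * phi (V w)) <= \int[mu]_w ((k w)%:E * phi (V w)).
Proof.
move=> hk mphi phi0.
rewrite -(integral_density_measure _ _ _ mh h0 mV)//.
rewrite -(integral_density_measure _ _ _ mk k0 mV)//.
exact: ge0_le_measure_integral.
Qed.

End density_comparison.

Section tuple_unique.
Context {R : realType} {dO dT : measure_display}.
Context {Omega : measurableType dO} {T : measurableType dT}.
Variable mu : {measure set Omega -> \bar R}.
Variables (h k : Omega -> R) (n : nat) (V : Omega -> n.-tuple T).
Hypotheses (mh : measurable_fun setT h) (h0 : forall w, 0 <= h w).
Hypotheses (mk : measurable_fun setT k) (k0 : forall w, 0 <= k w).
Hypothesis mV : measurable_fun setT V.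

Local Open Scope ereal_scope.

(** Rectangles are stable under intersection and generate the sigma-algebra of tuples, so two
    measures that agree on them coincide; finiteness of the total mass is what uniqueness
    requires. *)
Lemma eq_integral_tuple :
  \int[mu]_w (h w)%:E < +oo ->
  (forall A : 'I_n -> set T, (forall i, measurable (A i)) ->
    let D := [set w | forall i, A i (tnth (V w) i)] in
    \int[mu]_(w in D) (h w)%:E = \int[mu]_(w in D) (k w)%:E) ->
  forall B, measurable B ->
    \int[mu]_(w in V @^-1` B) (h w)%:E = \int[mu]_(w in V @^-1` B) (k w)%:E.
Proof.
move=> hfin hk.
pose G := [set B : set (n.-tuple T) | exists2 A : 'I_n -> set T,
   (forall i, measurable (A i)) & B = [set t | forall i, A i (tnth t i)]].
have GT : G setT.
  by exists (fun=> setT) => //; apply/seteqP; split.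
have mG : @measurable _ (n.-tuple T) = <<s G >>.
  apply/seteqP; split.
    apply: smallest_sub; first exact: smallest_sigma_algebra.
    move=> B; rewrite -bigcup_seq => -[i _ [A mA <-]].
    apply: sub_sigma_algebra.
    exists (fun j => if j == i then A else setT).
      by move=> j; case: ifPn.
    apply/seteqP; split => [t [_ At] j|t /(_ i)]; last by rewrite eqxx.
    by case: eqVneq => // ->.
  apply: smallest_sub; first exact: sigma_algebra_measurable.
  move=> _ [A mA ->].
  rewrite (_ : [set _ | _] = \bigcap_(i in [set: 'I_n]) ((@tnth n T)^~ i @^-1` A i)).
    apply: fin_bigcap_measurable => // i _.
    by rewrite -[X in measurable X]setTI; exact: measurable_tnth.
  by apply/seteqP; split => [t At i _|t At i]; exact: At.
pose m1 := density_measure mu _ _ mh h0 mV.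
pose m2 := density_measure mu _ _ mk k0 mV.
apply: (@measure_unique _ R _ G (fun=> setT) mG _ _ _ m1 m2) => //.
- move=> _ _ [A mA ->] [B mB ->]; exists (fun i => A i `&` B i).
    by move=> i; exact: measurableI.
  apply/seteqP; split => [t [At Bt] i|t ABt]; first by split.
  by split => i; have [] := ABt i.
- by apply/seteqP; split => // t _; exists 0%N.
- by move=> _ [A mA ->]; exact: hk.
Qed.

End tuple_unique.

(** * Conditional expectation *)

Section conditional_expectation_theory.
Context {R : realType} {dO dT : measure_display}.
Context {Omega : measurableType dO} {T : measurableType dT}.
Variable P : probability Omega R.

Local Open Scope ereal_scope.

(** Radon-Nikodym for the measure A |-> E[Z; V in A] with respect to the law of V. That law is
    written as a [density_measure] with density 1, so that [integral_density_measure] brings its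
    integrals back to Omega. *)
Lemma cond_expectation_exists (V : Omega -> T) (Z : Omega -> R) :
  measurable_fun setT V -> measurable_fun setT Z -> (forall w, 0 <= Z w)%R ->
  \int[P]_w (Z w)%:E < +oo ->
  exists2 phi : T -> \bar R, (forall v, phi v \is a fin_num) &
    cond_expectation_version P V (EFin \o Z) phi.
Proof.
move=> mV mZ Z0 Zfin.
have mVA A : measurable A -> measurable (V @^-1` A).
  by move=> mA; rewrite -[X in measurable X]setTI; exact: mV.
have m1 : measurable_fun setT (cst 1%R : Omega -> R) by exact: measurable_cst.
have h1 (w : Omega) : (0 <= (cst 1%R : Omega -> R) w)%R by [].
have [nu nuE] : exists nu : {finite_measure set T -> \bar R},
    forall A, nu A = \int[P]_(w in V @^-1` A) (Z w)%:E.
  pose nu := density_measure P _ _ mZ Z0 mV.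
  have fnu : fin_num_fun nu by apply: lty_fin_num_fun.
  pose nu' : {finite_measure set T -> \bar R} :=
    HB.pack nu (Measure_isFinite.Build _ _ _ nu fnu).
  by exists nu'.
have [mu muE] : exists mu : {finite_measure set T -> \bar R},
    forall A, mu A = density_measure P _ _ m1 h1 mV A.
  pose mu := density_measure P _ _ m1 h1 mV.
  have fmu : fin_num_fun mu.
    apply: lty_fin_num_fun; rewrite /mu/= /density_measure.
    rewrite preimage_setT (integral_cst P measurableT 1%E).
    by rewrite mul1e (le_lt_trans (probability_le1 P measurableT))// ltry.
  pose mu' : {finite_measure set T -> \bar R} :=
    HB.pack mu (Measure_isFinite.Build _ _ _ mu fmu).
  by exists mu'.
have numu : nu `<< mu.
  apply/null_content_dominatesP => A mA.
  move=> muA0; have PA0 : P (V @^-1` A) = 0.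
    rewrite -[LHS]mul1e -(integral_cst P (mVA _ mA) 1%E).
    by move: muA0; rewrite -[X in X = _ -> _]/(mu A) muE.
  rewrite -[LHS]/(nu A) nuE.
  rewrite integral_mkcond; rewrite (ae_eq_integral (cst 0))//; last 2 first.
  - rewrite -(measurable_restrictT (EFin \o Z)); last exact: mVA.
    by apply: (measurable_funS measurableT) => //; exact/measurable_EFinP.
  - exists (V @^-1` A); split => //; first exact: mVA.
    move=> w /= Hw; apply: contrapT => nA; apply: Hw => _.
    by rewrite patchE memNset.
  exact: integral0.
have [phi [phi0 phif phii phiE]] := radon_nikodym_sigma_finite numu.
exists phi => //; split => //.
  by move/integrableP : phii => [].
move=> B mB.
transitivity (nu B); last by rewrite nuE.
rewrite phiE//.
have mphi : measurable_fun setT phi by move/integrableP : phii => [].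
rewrite [RHS]integral_mkcond.
have mphiB : measurable_fun setT (phi \_ B).
  by rewrite -(measurable_restrictT phi)//; apply: (measurable_funS measurableT).
rewrite (eq_measure_integral (density_measure P _ _ m1 h1 mV)); last first.
  by move=> A mA _; exact: muE.
rewrite (integral_density_measure _ _ _ m1 h1 mV)//; last first.
  by move=> v; apply: erestrict_ge0 => ? _; exact: phi0.
rewrite [LHS]integral_mkcond; apply: eq_integral => w _.
by rewrite mul1e.
Qed.

Lemma cond_expectationP (V : Omega -> T) (Z : Omega -> \bar R) :
  (exists phi, cond_expectation_version P V Z phi) ->
  cond_expectation_version P V Z (cond_expectation P V Z).
Proof.
move=> [phi Hphi]; rewrite /cond_expectation.
by case: xgetP => [psi _ //|/(_ phi)]; exact: contra_notP.
Qed.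

Lemma ae_ex (Q : Omega -> Prop) : {ae P, forall w, Q w} -> exists w, Q w.
Proof.
move=> [N [mN N0 QN]]; apply: contrapT => /forallNP nQ.
have NT : N = setT by apply/seteqP; split => // w _; apply: QN; exact: nQ.
by move: N0; rewrite NT probability_setT => -[] /eqP; rewrite oner_eq0.
Qed.

(** Without a version the default value +oo would contradict the finite bound. Hence the subgaussian
    hypothesis of the model itself supplies a genuine version, with no prior integrability of the
    exponential. *)
Lemma ae_fin_cond_expectation_version (V : Omega -> T) (Z : Omega -> \bar R)
    (u : Omega -> R) :
  {ae P, forall w, cond_expectation P V Z (V w) <= (u w)%:E} ->
  cond_expectation_version P V Z (cond_expectation P V Z).
Proof.
move=> H; apply: cond_expectationP; apply: contrapT => /forallNP none.
have [w] := ae_ex _ H.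
by rewrite /cond_expectation xgetPN// leye_eq.
Qed.

Lemma ae_le_cst (V : Omega -> T) (phi : T -> \bar R) (c : R) : (0 <= c)%R ->
  measurable_fun setT V -> measurable_fun setT phi -> (forall v, 0 <= phi v) ->
  (forall B, measurable B ->
    \int[P]_(w in V @^-1` B) phi (V w) <= c%:E * P (V @^-1` B)) ->
  {ae P, forall w, phi (V w) <= c%:E}.
Proof.
move=> c0 mV mphi phi0 H.
(* Each level set [phi >= c + 1/(m+1)] is null by the hypothesis on its preimage, and their union
   over m is the set where [phi > c]. *)
pose B m := [set v | (c + m.+1%:R^-1)%:E <= phi v].
have mB m : measurable (B m).
  by rewrite -[X in measurable X]setTI; apply: emeasurable_fun_c_infty.
have mVB m : measurable (V @^-1` B m).
  by rewrite -[X in measurable X]setTI; exact: mV.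
have B0 m : P (V @^-1` B m) = 0.
  apply/eqP; rewrite eq_le measure_ge0 andbT.
  have : (c + m.+1%:R^-1)%:E * P (V @^-1` B m) <= c%:E * P (V @^-1` B m).
    apply: le_trans (H _ (mB m)).
    rewrite -integral_cst//; apply: ge0_le_integral => //.
    - by move=> w _; rewrite lee_fin addr_ge0.
    - by apply: (measurable_funS measurableT) => //; exact: measurableT_comp.
  have Pfin : P (V @^-1` B m) \is a fin_num by exact: fin_num_measure.
  rewrite -(fineK Pfin) -!EFinM !lee_fin mulrDl gerDl.
  by rewrite pmulr_rle0 ?invr_gt0.
have : P.-negligible (\bigcup_m (V @^-1` B m)).
  apply: negligible_bigcup => m; exists (V @^-1` B m).
  by split; [exact: mVB|exact: B0|].
apply: negligibleS => w /= /negP; rewrite -ltNge => cphi.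
have : exists m, (c + m.+1%:R^-1)%:E <= phi (V w).
  case: (phi (V w)) cphi => [r| |//]; last by exists 0%N; rewrite leey.
  rewrite lte_fin => cr.
  have rc : (0 < r - c)%R by rewrite subr_gt0.
  have [m Hm] := ltr_add_invr cr.
  by exists m; rewrite lee_fin ltW.
by move=> [m Hm]; exists m.
Qed.

Lemma cond_expectation_le (V : Omega -> T) (Z : Omega -> R) (c : R) :
  (0 <= c)%R -> measurable_fun setT V -> measurable_fun setT Z ->
  (forall w, 0 <= Z w)%R ->
  (forall B, measurable B ->
    \int[P]_(w in V @^-1` B) (Z w)%:E <= c%:E * P (V @^-1` B)) ->
  {ae P, forall w, cond_expectation P V (EFin \o Z) (V w) <= c%:E}.
Proof.
move=> c0 mV mZ Z0 H.
have Zfin : \int[P]_w (Z w)%:E < +oo.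
  have := H setT measurableT; rewrite preimage_setT => /le_lt_trans; apply.
  by rewrite probability_setT mule1 ltry.
have [phi _ Hphi] := cond_expectation_exists _ _ mV mZ Z0 Zfin.
have [mpsi psi0 psiE] : cond_expectation_version P V (EFin \o Z)
    (cond_expectation P V (EFin \o Z)).
  by apply: cond_expectationP; exists phi.
by apply: ae_le_cst => // B mB; rewrite psiE//; exact: H.
Qed.

End conditional_expectation_theory.

(** * Independence and mixtures *)

Lemma measurable_prodr {R : realType} {d : measure_display}
    {T : measurableType d} (I : Type) (s : seq I) (Q : pred I) (f : I -> T -> R) :
  (forall i, measurable_fun setT (f i)) ->
  measurable_fun setT (fun x => \prod_(i <- s | Q i) f i x).
Proof.
move=> mf; elim: s => [|i s IHs].
  by rewrite (_ : (fun _ => _) = cst 1)//; apply/funext => x; rewrite big_nil.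
rewrite (_ : (fun _ => _) =
    fun x => if Q i then f i x * \prod_(j <- s | Q j) f j x
             else \prod_(j <- s | Q j) f j x).
  by case: (Q i) => //; exact: measurable_funM.
by apply/funext => x; rewrite big_cons.
Qed.

Section independence.
Context {R : realType} {dO dT : measure_display}.
Context {Omega : measurableType dO} {T : measurableType dT}.
Variable P : probability Omega R.
Variables (n : nat) (Z : 'I_n -> Omega -> T).
Hypothesis mZ : forall i, measurable_fun setT (Z i).

Local Open Scope ereal_scope.

Hypothesis indepZ : forall A : 'I_n -> set T, (forall i, measurable (A i)) ->
  P [set w | forall i, A i (Z i w)] = \prod_(i < n) P (Z i @^-1` A i).

Let mZA i A : measurable A -> measurable (Z i @^-1` A).
Proof. by move=> mA; rewrite -[X in measurable X]setTI; exact: mZ. Qed.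

Lemma independent_integral_prod (psi : 'I_n -> T -> R) :
  (forall i, measurable_fun setT (psi i)) -> (forall i x, 0 <= psi i x)%R ->
  (forall i, \int[P]_w (psi i (Z i w))%:E < +oo) ->
  \int[P]_w (\prod_(i < n) psi i (Z i w))%:E =
  \prod_(i < n) \int[P]_w (psi i (Z i w))%:E.
Proof.
move=> mpsi psi0 psifin.
(* Induction on k, where all factors of index at least k are indicators. For k = 0 this is the
   independence hypothesis; for k = n it is the claim. *)
suff H k : forall psi : 'I_n -> T -> R,
  (forall i, measurable_fun setT (psi i)) -> (forall i x, 0 <= psi i x)%R ->
  (forall i, \int[P]_w (psi i (Z i w))%:E < +oo) ->
  (forall i : 'I_n, (k <= i)%N -> exists2 A, measurable A & psi i = \1_A) ->
  \int[P]_w (\prod_(i < n) psi i (Z i w))%:E =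
  \prod_(i < n) \int[P]_w (psi i (Z i w))%:E.
  by apply: (H n) => // i; rewrite leqNgt ltn_ord.
move=> {psi mpsi psi0 psifin}; elim: k => [|k IH] psi mpsi psi0 psifin psiA.
  have /choice[A HA] : forall i, exists A, measurable A /\ psi i = \1_A.
    by move=> i; have [//|A mA ->] := psiA i; exists A.
  have mA i : measurable (A i) by have [] := HA i.
  have psiE i : psi i = \1_(A i) by have [] := HA i.
  have E i : \int[P]_w (psi i (Z i w))%:E = P (Z i @^-1` A i).
    rewrite -[in RHS](setIT (Z i @^-1` A i)) -integral_indic//; last exact: mZA.
    by apply: eq_integral => w _; rewrite psiE.
  under eq_bigr do rewrite E.
  rewrite -indepZ// -[X in P X]setIT -integral_indic//; last first.
    rewrite (_ : [set _ | _] = \bigcap_(i in [set: 'I_n]) (Z i @^-1` A i)).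
      by apply: fin_bigcap_measurable => // i _; exact: mZA.
    by apply/seteqP; split => [w Aw i _|w Aw i]; exact: Aw.
  apply: eq_integral => w _; congr EFin.
  have [Aw|Aw] := pselect (forall i, A i (Z i w)).
    rewrite indicE mem_set// big1// => i _.
    by rewrite psiE indicE mem_set.
  rewrite indicE memNset//; move/existsNP : Aw => [i Aw].
  by rewrite (bigD1 i)//= psiE indicE memNset ?mul0r.
have [kn|nk] := ltnP k n; last first.
  by apply: IH => // i ki; move: (ltn_ord i); rewrite ltnNge (leq_trans nk).
pose i0 := Ordinal kn.
pose h w := (\prod_(i < n | i != i0) psi i (Z i w))%R.
pose c := \prod_(i < n | i != i0) \int[P]_w (psi i (Z i w))%:E.
have int0 i : 0 <= \int[P]_w (psi i (Z i w))%:E.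
  by apply: integral_ge0 => w _; rewrite lee_fin.
have cfin : c \is a fin_num.
  by apply: prode_fin_num => i _; rewrite ge0_fin_numE.
have c0 : (0 <= fine c)%R by rewrite fine_ge0// prode_ge0.
have mh : measurable_fun setT h.
  by apply: measurable_prodr => i; exact: measurableT_comp.
have h0 w : (0 <= h w)%R by apply: prodr_ge0.
have mc : measurable_fun setT (cst (fine c) : Omega -> R) by exact: measurable_cst.
(* With an indicator in place of factor k, the induction hypothesis says that the weight [h], the
   product of the other factors, and the constant c define the same measure on events of [Z i0].
   Integrating [psi i0] against both frees factor k. *)
have hA A : measurable A -> \int[P]_(w in Z i0 @^-1` A) (h w)%:E =
   \int[P]_(w in Z i0 @^-1` A) (cst (fine c) w)%:E.
  move=> mA.
  pose psi' i := if i == i0 then \1_A : T -> R else psi i.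
  have iA : \int[P]_w (\1_A (Z i0 w) : R)%:E = P (Z i0 @^-1` A).
    by rewrite -[in RHS](setIT (Z i0 @^-1` A)) -integral_indic//; exact: mZA.
  have := IH psi'; rewrite (bigD1 i0)//= /psi' eqxx.
  rewrite (eq_bigr (fun i => \int[P]_w (psi i (Z i w))%:E)); last first.
    by move=> i /negbTE ii0; apply: eq_integral => w _; rewrite ii0.
  rewrite -/c iA (integral_cst P (mZA i0 A mA) (fine c)%:E) fineK// => IH'.
  rewrite muleC -IH'; last 4 first.
  - by move=> i; case: ifPn => // _; exact: measurable_indic.
  - by move=> i x; case: ifPn.
  - move=> i; case: eqVneq => [->|//]; rewrite iA.
    by rewrite (le_lt_trans (probability_le1 P _)) ?ltry//; exact: mZA.
  - move=> i ki; case: eqVneq => [_|ii0]; first by exists A.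
    apply: psiA; rewrite ltn_neqAle ki andbT.
    by apply: contraNneq ii0 => kE; apply/eqP/val_inj.
  rewrite integral_mkcond; apply: eq_integral => w _.
  rewrite epatch_indic/= -EFinM (bigD1 i0)//= eqxx mulrC; congr (_ * _)%:E.
  by apply: eq_bigr => i /negbTE ->.
have mphi : measurable_fun setT (EFin \o psi i0) by exact/measurable_EFinP.
rewrite (bigD1 i0)//= -/c.
transitivity (\int[P]_w ((h w)%:E * (EFin \o psi i0) (Z i0 w))).
  by apply: eq_integral => w _; rewrite (bigD1 i0)//= mulrC EFinM.
transitivity (\int[P]_w ((cst (fine c) w)%:E * (EFin \o psi i0) (Z i0 w))).
  apply/eqP; rewrite eq_le; apply/andP; split.
    by apply: le_integral_density => // [A mA|v]; rewrite ?hA// lee_fin.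
  by apply: le_integral_density => // [A mA|v]; rewrite ?hA// lee_fin.
transitivity (\int[P]_w ((fine c)%:E * (psi i0 (Z i0 w))%:E)) => //.
rewrite ge0_integralZl//; last 2 first.
- by apply/measurable_EFinP; exact: measurableT_comp.
- by move=> w _; rewrite lee_fin.
by rewrite fineK// muleC.
Qed.

End independence.

Lemma independent_family_prefix {R : realType} {dO dT : measure_display}
    {Omega : measurableType dO} {T : measurableType dT}
    (P : probability Omega R) (Z : nat -> Omega -> T) (n : nat) :
  independent_family P Z ->
  forall A : 'I_n -> set T, (forall i, measurable (A i)) ->
  P [set w | forall i : 'I_n, A i (Z i w)] =
  (\prod_(i < n) P (Z i @^-1` A i))%E.
Proof.
move=> indep A mA.
pose A' i := if insub i is Some j then A j else setT.
have A'E (i : 'I_n) : A' i = A i by rewrite /A' valK.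
have mA' i : measurable (A' i) by rewrite /A'; case: insubP.
have := indep [fset i in iota 0 n]%fset A' mA'.
rewrite (perm_big (index_iota 0 n)) /=; last first.
  apply: uniq_perm; rewrite ?fset_uniq ?iota_uniq// => i.
  by rewrite /index_iota subn0 !inE.
rewrite big_mkord => H.
rewrite (eq_bigr (fun i : 'I_n => P (Z i @^-1` A' i))); last first.
  by move=> i _; rewrite A'E.
rewrite -H; congr (P _); apply/seteqP; split => [w Aw i/=|w Aw i].
  rewrite !inE mem_iota/= add0n => ilt.
  by have := Aw (Ordinal ilt); rewrite -A'E.
by rewrite -A'E; apply: Aw; rewrite /= !inE mem_iota add0n ltn_ord.
Qed.

Section mixture.
Context {R : realType} {dO : measure_display} {Omega : measurableType dO}.
Variable P : probability Omega R.

Local Open Scope ereal_scope.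

(** W sums all [phi k i] with weights 1 / (2^(k+1) #|I k|), of total mass at most 1. As every term
    is nonnegative, a single one is at most W times its inverse weight. W precedes D, so one average
    serves all design events. *)
Lemma mixture_exists (I : nat -> finType) (phi : forall k, I k -> Omega -> R) :
  (forall k i, measurable_fun setT (phi k i)) ->
  (forall k i w, 0 <= phi k i w)%R ->
  exists W : Omega -> \bar R, [/\ measurable_fun setT W, forall w, 0 <= W w,
    forall D, measurable D ->
      (forall k i, \int[P]_(w in D) (phi k i w)%:E <= P D) ->
      \int[P]_(w in D) W w <= P D &
    forall k i w, (phi k i w)%:E <= (2 ^+ k.+1 * #|I k|%:R)%:E * W w].
Proof.
move=> mphi phi0.
pose q k := (2 ^+ k.+1 * #|I k|%:R : R)%R.
have q0 k : (0 <= q k)%R by rewrite mulr_ge0.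
pose f k w := \sum_(i : I k) ((q k)^-1 * phi k i w)%:E.
have f0 k w : 0 <= f k w.
  by apply: sume_ge0 => i _; rewrite lee_fin mulr_ge0// invr_ge0.
have mf k D : measurable_fun D (f k).
  apply: (measurable_funS measurableT) => //.
  apply: emeasurable_sum => i; apply/measurable_EFinP.
  exact: measurable_funM.
pose W w := \sum_(k <oo) f k w.
exists W; split.
- by apply: ge0_emeasurable_sum => // k w _ _; exact: f0.
- by move=> w; apply: nneseries_ge0.
- move=> D mD Dphi.
  rewrite /W integral_nneseries//.
  have PDfin : P D \is a fin_num by exact: fin_num_measure.
  rewrite -[leRHS]fineK//; apply: le_trans (epsilon_trick0 xpredT _); last first.
    by rewrite fine_ge0.
  apply: lee_nneseries => k _; first by rewrite integral_ge0.
  rewrite /f ge0_integral_sum//; last 2 first.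
  + move=> i; apply: (measurable_funS measurableT) => //; apply/measurable_EFinP.
    exact: measurable_funM.
  + by move=> i w _; rewrite lee_fin mulr_ge0// invr_ge0.
  apply: (@le_trans _ _ (\sum_(i : I k) ((q k)^-1 * fine (P D))%:E)).
    apply: lee_sum => i _.
    under eq_integral do rewrite EFinM.
    rewrite ge0_integralZl//; last 3 first.
    * by apply: (measurable_funS measurableT) => //; apply/measurable_EFinP.
    * by move=> w _; rewrite lee_fin.
    * by rewrite lee_fin invr_ge0.
    by rewrite EFinM fineK// lee_wpmul2l// lee_fin invr_ge0.
  rewrite sumEFin lee_fin sumr_const /q.
  have [->|I0] := eqVneq #|I k| 0%N.
    by rewrite mulr0n divr_ge0 ?fine_ge0// mulr1 natrX.
  rewrite -[#|xpredT|]/#|I k| natrX -[leLHS]mulr_natr.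
  rewrite le_eqVlt; apply/orP; left; apply/eqP; field.
  by rewrite pnatr_eq0 I0 expf_neq0.
- move=> k i w.
  have Ik : (0 < #|I k|)%N by apply/card_gt0P; exists i.
  have qk : (0 < q k)%R by rewrite mulr_gt0// ltr0n.
  rewrite -/(q k) muleC -lee_pdivrMr//.
  rewrite -EFinM mulrC.
  apply: (@le_trans _ _ (f k w)).
    rewrite /f (bigD1 i)//= leeDl// sume_ge0// => j _.
    by rewrite lee_fin mulr_ge0// invr_ge0.
  apply: (@le_trans _ _ (\sum_(0 <= j < k.+1) f j w)).
    by rewrite big_nat_recr//= leeDr// sume_ge0.
  exact: nneseries_lim_ge.
Qed.

End mixture.

(** * Measurability on the cube *)

Section borel_row_vectors.
Context {R : realType} {d : nat}.
Implicit Types (f : 'rV[R]_d -> R) (x : 'rV[R]_d).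

Lemma measurable_within_continuous f (D : set 'rV[R]_d) :
  measurable D -> {within D, continuous f} -> measurable_fun D f.
Proof.
move=> mD cf; apply: (measurability _ (RGenOInfty.measurableE R)) => //.
move=> _ [_ [a ->] <-].
have /open_subspaceP[V oV VE] : open (f @^-1` `]a, +oo[ : set (subspace D)).
  by move/continuousP : cf; apply; exact: interval_open.
rewrite setIC -VE; apply: measurableI => //.
exact: sub_sigma_algebra.
Qed.

Lemma measurable_coord (i : 'I_d) : measurable_fun setT (fun x => x ord0 i).
Proof.
apply: measurable_within_continuous => //.
by apply: continuous_subspaceT; exact: coord_continuous.
Qed.

Lemma measurable_cube : measurable (cube d : set 'rV[R]_d).
Proof.
rewrite (_ : cube d = \bigcap_(i in [set: 'I_d])
    ((fun x => x ord0 i) @^-1` `[0, 1]%classic)).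
  apply: fin_bigcap_measurable => // i _.
  by rewrite -[X in measurable X]setTI; exact: measurable_coord.
by apply/seteqP; split => [x xc i _|x xc i] /=;
  [rewrite in_itv/=; exact: xc|have := xc i I; rewrite /= in_itv].
Qed.

(** Rounding down keeps a point of the cube inside the cube, the only place where continuity is
    known, and takes finitely many values there. *)
Definition grid (m : nat) x : 'rV[R]_d :=
  \row_i ((Num.truncn (m.+1%:R * x ord0 i))%:R / m.+1%:R).

Lemma grid_cube m x : cube d x -> cube d (grid m x).
Proof.
move=> xc i; rewrite !mxE; have /andP[x0 x1] := xc i.
rewrite divr_ge0//= ler_pdivrMr// mul1r ler_nat.
rewrite -ltnS truncn_lt_nat ?mulr_ge0// (@le_lt_trans _ _ (m.+1%:R))//.
  by rewrite -[leRHS]mulr1 ler_pM2l.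
by rewrite ltr_nat.
Qed.

Lemma grid_cvg x : cube d x -> grid m x @[m --> \oo] --> x.
Proof.
move=> xc U [B Bx BU].
suff : \forall m \near \oo, forall i : 'I_1, forall j, B i j (grid m x i j).
  by apply: filterS => m Bm; exact: BU.
apply: filter_forall => i; apply: filter_forall => j.
suff : grid m x i j @[m --> \oo] --> x i j by apply; exact: Bx.
rewrite (ord1 i); apply/cvgrPdist_lt => e e0.
near=> m; rewrite !mxE; set t := Num.truncn _.
have /andP[x0 _] := xc j.
have m0 : (0 : R) < m.+1%:R by [].
have /andP[t1 t2] : t%:R <= m.+1%:R * x ord0 j < t.+1%:R.
  by apply: truncn_itv; rewrite mulr_ge0.
rewrite ger0_norm; last by rewrite subr_ge0 ler_pdivrMr// mulrC.
apply: (@lt_le_trans _ _ m.+1%:R^-1).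
  rewrite ltrBlDl -(ltr_pM2l m0) mulrDr mulfV// mulrCA mulfV// mulr1.
  by rewrite natr1.
by apply: ltW; near: m; exact: (near_infty_natSinv_lt (PosNum e0)).
Unshelve. all: by end_near. Qed.

Lemma within_continuous_grid f x : {within cube d, continuous f} -> cube d x ->
  f (grid m x) @[m --> \oo] --> f x.
Proof.
move=> /subspace_continuousP /(_ x) cf xc.
apply: cvg_trans (cf xc) => U /= fU.
have H : \forall m \near \oo, cube d (grid m x) -> U (f (grid m x)).
  exact: (grid_cvg _ xc _ fU).
suff : \forall m \near \oo, U (f (grid m x)) by [].
by apply: filterS H => m; apply; exact: grid_cube.
Qed.

(* [g w (X w)] is the limit of [g w] at [X w] rounded to ever finer finite grids. *)
Lemma measurable_caratheodory {dO : measure_display} {Omega : measurableType dO}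
    (g : Omega -> 'rV[R]_d -> R) (X : Omega -> 'rV[R]_d) :
  measurable_fun setT X -> (forall w, cube d (X w)) ->
  (forall x, cube d x -> measurable_fun setT (g ^~ x)) ->
  (forall w, {within cube d, continuous (g w)}) ->
  measurable_fun setT (fun w => g w (X w)).
Proof.
move=> mX Xc mg cg.
apply: (@measurable_fun_cvg _ _ _ _ (fun m w => g w (grid m (X w)))); last first.
  by move=> w _; exact: within_continuous_grid.
move=> m _ B mB; rewrite setTI.
(* There are m + 2 values per coordinate: the coordinate 1 is rounded to (m+1)/(m+1). *)
pose r (k : {ffun 'I_d -> 'I_m.+2}) : 'rV[R]_d :=
  \row_i ((k i)%:R / m.+1%:R).
pose E (k : {ffun 'I_d -> 'I_m.+2}) := [set w | forall i,
  (k i)%:R <= m.+1%:R * X w ord0 i < (k i).+1%:R].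
have mE k : measurable (E k).
  rewrite (_ : E k = \bigcap_(i in [set: 'I_d])
    ((fun w => m.+1%:R * X w ord0 i) @^-1`
      [set` Interval (BLeft (k i)%:R) (BLeft (k i).+1%:R)])).
    apply: fin_bigcap_measurable => // i _.
    rewrite -[X in measurable X]setTI.
    have mXi : measurable_fun setT (fun w => m.+1%:R * X w ord0 i).
      apply: measurable_funM => //.
      exact: (measurableT_comp (measurable_coord i)).
    exact: mXi.
  by apply/seteqP; split => [w wE i _|w wE i] /=;
    [rewrite in_itv/=; exact: wE|have := wE i I; rewrite /= in_itv].
have Er k w : E k w -> grid m (X w) = r k.
  move=> Ew; apply/rowP => i; rewrite !mxE; congr (_%:R / _).
  exact: truncn_def.
have EX w : exists k, E k w /\ cube d (r k).
  have t2 i : (Num.truncn (m.+1%:R * X w ord0 i) < m.+2)%N.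
    have /andP[x0 x1] := Xc w i.
    rewrite truncn_lt_nat ?mulr_ge0// (@le_lt_trans _ _ (m.+1%:R))//.
      by rewrite -[leRHS]mulr1 ler_pM2l.
    by rewrite ltr_nat.
  pose k : {ffun 'I_d -> 'I_m.+2} := [ffun i => Ordinal (t2 i)].
  have Ek : E k w.
    move=> i; rewrite ffunE/=; apply: truncn_itv.
    by have /andP[x0 _] := Xc w i; rewrite mulr_ge0.
  by exists k; split => //; rewrite -(Er _ _ Ek); exact: grid_cube.
(* Only grid points in the cube are kept in the union, since measurability of [g ^~ x] is available
   for those alone. *)
rewrite (_ : _ @^-1` B = \bigcup_(k in [set k | cube d (r k)])
    (E k `&` (g ^~ (r k) @^-1` B))); last first.
  apply/seteqP; split => [w gB|w [k rk [Ek gB]]].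
    have [k [Ek rk]] := EX w.
    by exists k => //; split => //=; rewrite -(Er _ _ Ek).
  by rewrite /preimage/= (Er _ _ Ek).
apply: fin_bigcup_measurable => // k rk; apply: measurableI => //.
by rewrite -[X in measurable X]setTI; exact: mg.
Qed.

End borel_row_vectors.

(** * Subgaussian noise given the design *)

Section conditional_subgaussian.
Context {R : realType} {dO dT : measure_display}.
Context {Omega : measurableType dO} {T : measurableType dT}.
Variable P : probability Omega R.
Variables (X : Omega -> T) (e : Omega -> R).
Hypotheses (mX : measurable_fun setT X) (me : measurable_fun setT e).

Local Open Scope ereal_scope.

Let mXA A : measurable A -> measurable (X @^-1` A).
Proof. by move=> mA; rewrite -[X in measurable X]setTI; exact: mX. Qed.

(** Conditional subgaussianity with variance proxy v, for t of either sign, integrated over events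
    of X. In this form t can be replaced by a function of X, on level sets first and then in the
    limit. *)
Definition subgaussian_given (v : R) := forall t A, measurable A ->
  \int[P]_(w in X @^-1` A) (expR (t * e w - v * t ^+ 2 / 2))%:E <= P (X @^-1` A).

Import HBSimple.

Lemma measurable_expR_scaled (u : T -> R) (v : R) (D : set Omega) :
  measurable_fun setT u ->
  measurable_fun D (fun w => expR (u (X w) * e w - v * u (X w) ^+ 2 / 2)).
Proof.
move=> mu; apply: (measurable_funS measurableT) => //.
have muX : measurable_fun setT (u \o X) by exact: measurableT_comp.
apply: (measurableT_comp (continuous_measurable_fun (@continuous_expR R))).
apply: measurable_funB; first exact: measurable_funM.
apply: measurable_funM => //; apply: measurable_funM => //.
exact: measurable_funX.
Qed.

Lemma subgaussian_given_sfun (v : R) (u : {sfun T >-> R}) A :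
  subgaussian_given v -> measurable A ->
  \int[P]_(w in X @^-1` A)
    (expR (u (X w) * e w - v * u (X w) ^+ 2 / 2))%:E <= P (X @^-1` A).
Proof.
move=> He mA.
(* On the level set u = c the random factor u(X) is the constant c, and [subgaussian_given] applies
   to the intersection of A with that set. *)
pose B c := u @^-1` [set c].
have mB c : measurable (B c) by exact: measurable_sfunP.
pose g c w := (expR (c * e w - v * c ^+ 2 / 2))%R.
have mg c : measurable_fun setT (g c).
  exact: (measurable_expR_scaled (cst c) v setT (measurable_cst _)).
have split_sum (F : R -> R) w :
    (F (u (X w)))%:E = \sum_(c \in range u) (F c * \1_(X @^-1` (B c)) w)%:E.
  rewrite fsumEFin//; congr EFin.
  rewrite (fsbigD1 (u (X w)))//=; last by exists (X w).
  rewrite indicE mem_set// mulr1 fsbig1 ?addr0// => c [_ /= cu].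
  by rewrite indicE memNset ?mulr0// => /= uc; apply: cu.
have mI c : measurable_fun setT (\1_(X @^-1` (B c)) : Omega -> R).
  by apply: measurable_indic; exact: mXA.
have g0 c w : (0 <= g c w)%R by exact: expR_ge0.
have -> : P (X @^-1` A) = \int[P]_(w in X @^-1` A)
    (\sum_(c \in range u) (1 * \1_(X @^-1` (B c)) w : R)%:E).
  rewrite -[LHS]mul1e -(integral_cst P (mXA _ mA) 1); apply: eq_integral => w _.
  by rewrite -(split_sum (fun=> 1%R)).
under eq_integral do rewrite (split_sum (fun c => g c _)).
have mgI c D : measurable_fun D (fun w => (g c w * \1_(X @^-1` (B c)) w)%:E).
  apply: (measurable_funS measurableT) => //; apply/measurable_EFinP.
  exact: measurable_funM.
have m1I c D : measurable_fun D (fun w => (1 * \1_(X @^-1` (B c)) w : R)%:E).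
  apply: (measurable_funS measurableT) => //; apply/measurable_EFinP.
  exact: measurable_funM.
have mXA' := mXA _ mA.
rewrite !ge0_integral_fsum//; try by move=> c w _; rewrite lee_fin mulr_ge0.
apply: lee_fsum => // c _.
have H (F : Omega -> R) : \int[P]_(w in X @^-1` A) (F w * \1_(X @^-1` (B c)) w)%:E
    = \int[P]_(w in X @^-1` (A `&` B c)) (F w)%:E.
  rewrite preimage_setI integral_mkcondr; apply: eq_integral => w _.
  by rewrite epatch_indic EFinM.
rewrite (H (fun=> 1%R)) H (integral_cst P _ 1) ?mul1e; last first.
  by apply: mXA; exact: measurableI.
by apply: He; exact: measurableI.
Qed.

Lemma limn_einf_le_cst (u : (\bar R)^nat) (c : \bar R) :
  (forall n, u n <= c) -> limn_einf u <= c.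
Proof.
move=> uc; rewrite limn_einf_lim; apply: lime_le; first exact: is_cvg_einfs.
apply: nearW => n; apply: le_trans (uc n).
by apply: ereal_inf_lbound; exists n => /=.
Qed.

Lemma subgaussian_given_fun (v : R) (u : T -> R) A :
  subgaussian_given v -> measurable_fun setT u -> measurable A ->
  \int[P]_(w in X @^-1` A)
    (expR (u (X w) * e w - v * u (X w) ^+ 2 / 2))%:E <= P (X @^-1` A).
Proof.
move=> He mu mA.
have mEu : measurable_fun setT (EFin \o u) by exact/measurable_EFinP.
have [s su] := approximation_sfun measurableT mEu.
have cvgs w : (expR (s n (X w) * e w - v * s n (X w) ^+ 2 / 2))%:E @[n --> \oo]
    --> (expR (u (X w) * e w - v * u (X w) ^+ 2 / 2))%:E.
  have su' : s n (X w) @[n --> \oo] --> u (X w).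
    by have := su (X w) I; move/fine_cvgP => [].
  apply: cvg_EFin; first exact: nearW.
  apply: (@continuous_cvg _ _ _ _ _ (fun n => s n (X w) * e w - v * s n (X w) ^+ 2 / 2)%R expR).
    exact: continuous_expR.
  apply: cvgB; first by apply: cvgMl.
  by apply: cvgMl; apply: cvgMr; apply: cvgM.
(* The integrands along simple approximations of u converge pointwise to the wanted one, and Fatou
   keeps the upper bound. *)
rewrite (eq_integral (fun w => limn_einf (fun n =>
    (expR (s n (X w) * e w - v * s n (X w) ^+ 2 / 2))%:E))); last first.
  move=> w _; rewrite is_cvg_limn_einfE; last by apply/cvg_ex; eexists; exact: cvgs.
  by apply/esym/cvg_lim => //; exact: cvgs.
apply: le_trans (fatou P _ _ _) _.
- exact: mXA.
- by move=> n; apply/measurable_EFinP; exact: measurable_expR_scaled.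
- by move=> n w _; rewrite lee_fin expR_ge0.
by apply: limn_einf_le_cst => n; exact: subgaussian_given_sfun.
Qed.

Lemma subgaussian_given_scale (v c : R) :
  subgaussian_given v -> forall t A, measurable A ->
  \int[P]_(w in X @^-1` A)
    (expR (t * (c * e w) - v * c ^+ 2 * t ^+ 2 / 2))%:E <= P (X @^-1` A).
Proof.
move=> He t A mA; apply: le_trans (He (t * c)%R A mA).
rewrite le_eqVlt; apply/orP; left; apply/eqP; apply: eq_integral => w _.
by congr (expR _)%:E; ring.
Qed.

End conditional_subgaussian.

(** * From single observations to events of the whole design *)

Section design_conditioning.
Context {R : realType} {dO d1 d2 : measure_display}.
Context {Omega : measurableType dO} {T1 : measurableType d1}.
Context {T2 : measurableType d2}.
Variable P : probability Omega R.
Variables (n : nat) (X : 'I_n -> Omega -> T1) (Y : 'I_n -> Omega -> T2).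
Hypotheses (mX : forall i, measurable_fun setT (X i)).
Hypotheses (mY : forall i, measurable_fun setT (Y i)).

Local Open Scope ereal_scope.

Hypothesis indepXY : forall A : 'I_n -> set (T1 * T2),
  (forall i, measurable (A i)) ->
  P [set w | forall i, A i (X i w, Y i w)] =
  \prod_(i < n) P ((fun w => (X i w, Y i w)) @^-1` A i).

Let V w : n.-tuple T1 := [tuple X i w | i < n].

Let mZ i : measurable_fun setT (fun w => (X i w, Y i w)).
Proof. by apply/measurable_fun_pairP; split; [exact: mX|exact: mY]. Qed.

Let mXA i A : measurable A -> measurable (X i @^-1` A).
Proof. by move=> mA; rewrite -[X in measurable X]setTI; exact: mX. Qed.

Lemma measurable_tuple_of : measurable_fun setT V.
Proof.
apply/measurable_fun_tnthP => i; rewrite (_ : _ \o _ = X i)//.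
by apply/funext => w /=; rewrite tnth_mktuple.
Qed.

Lemma integral_rectangle (phi : 'I_n -> T1 * T2 -> R) (A : 'I_n -> set T1) :
  (forall i, measurable_fun setT (phi i)) -> (forall i z, 0 <= phi i z)%R ->
  (forall i, \int[P]_w (phi i (X i w, Y i w))%:E < +oo) ->
  (forall i, measurable (A i)) ->
  \int[P]_(w in [set w | forall i, A i (tnth (V w) i)])
    (\prod_(i < n) phi i (X i w, Y i w))%:E =
  \prod_(i < n) \int[P]_(w in X i @^-1` A i) (phi i (X i w, Y i w))%:E.
Proof.
move=> mphi phi0 phifin mA.
pose psi i (z : T1 * T2) := (phi i z * \1_(A i) z.1)%R.
have mpsi i : measurable_fun setT (psi i).
  apply: measurable_funM => //.
  exact: (measurableT_comp (f := \1_(A i) : T1 -> R) (@measurable_indic _ _ _ _ _ (mA i)) measurable_fst).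
have psi0 i z : (0 <= psi i z)%R by rewrite mulr_ge0.
have psiE i : \int[P]_w (psi i (X i w, Y i w))%:E =
    \int[P]_(w in X i @^-1` A i) (phi i (X i w, Y i w))%:E.
  rewrite [RHS]integral_mkcond; apply: eq_integral => w _.
  by rewrite epatch_indic EFinM.
transitivity (\prod_(i < n) \int[P]_w (psi i (X i w, Y i w))%:E); last first.
  by apply: eq_bigr => i _; exact: psiE.
rewrite -(independent_integral_prod P n (fun i w => (X i w, Y i w)))//; last first.
  move=> i; apply: le_lt_trans (phifin i); rewrite psiE.
  apply: ge0_subset_integral => //; first exact: mXA.
  - by apply/measurable_EFinP; exact: (measurableT_comp (mphi i)).
  - by move=> w _; rewrite lee_fin.
rewrite integral_mkcond; apply: eq_integral => w _.
rewrite patchE; case: ifPn => [|]; rewrite ?notin_setE ?inE /= => Aw.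
  congr EFin; apply: eq_bigr => i _.
  have := Aw i; rewrite tnth_mktuple => Ai.
  by rewrite /psi/= indicE mem_set// mulr1.
move/existsNP : Aw => [i]; rewrite tnth_mktuple => Ai.
by rewrite (bigD1 i)//= /psi/= indicE memNset// mulr0 mul0r.
Qed.

(** Uniqueness of measures transfers equalities from rectangles to arbitrary design events. So each
    factor is replaced by its conditional expectation given its own covariate, which preserves the
    integral over rectangles, and only then is the almost sure bound by 1 used. *)
Lemma integral_prod_given_design (G : T1 * T2 -> R) :
  measurable_fun setT G -> (forall z, 0 <= G z)%R ->
  (forall i A, measurable A ->
    \int[P]_(w in X i @^-1` A) (G (X i w, Y i w))%:E <= P (X i @^-1` A)) ->
  forall B, measurable B ->
  \int[P]_(w in V @^-1` B) (\prod_(i < n) G (X i w, Y i w))%:E <= P (V @^-1` B).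
Proof.
move=> mG G0 GP B mB.
have mGZ i : measurable_fun setT (fun w => G (X i w, Y i w)).
  exact: (measurableT_comp mG (mZ i)).
have Gfin i : \int[P]_w (G (X i w, Y i w))%:E < +oo.
  have := GP i setT measurableT; rewrite preimage_setT => /le_lt_trans; apply.
  by rewrite probability_setT ltry.
have /choice[phi Hphi] : forall i, exists phi : T1 -> \bar R,
    (forall v, phi v \is a fin_num) /\
    cond_expectation_version P (X i) (EFin \o (fun w => G (X i w, Y i w))) phi.
  move=> i.
  have [//|phi phif phiv] := cond_expectation_exists P (X i) _ (mX i) (mGZ i) _ (Gfin i).
  by exists phi.
have phif i v : phi i v \is a fin_num by have [] := Hphi i.
have mphi i : measurable_fun setT (phi i) by have [_ []] := Hphi i.
have phi0 i v : 0 <= phi i v by have [_ []] := Hphi i.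
have phiE i A : measurable A -> \int[P]_(w in X i @^-1` A) phi i (X i w) =
    \int[P]_(w in X i @^-1` A) (G (X i w, Y i w))%:E.
  by move=> mA; have [_ [_ _ H]] := Hphi i; rewrite H.
have phi1 i : {ae P, forall w, phi i (X i w) <= 1%:E}.
  by apply: ae_le_cst => // A mA; rewrite phiE// mul1e; exact: GP.
pose g i (z : T1 * T2) := fine (phi i z.1).
have mg i : measurable_fun setT (g i).
  apply: (measurableT_comp (f := fun x => fine (phi i x))) => //.
  exact: (measurableT_comp (@fine_measurable _ _ measurableT) (mphi i)).
have g0 i z : (0 <= g i z)%R by exact: fine_ge0.
have gE i w : (g i (X i w, Y i w))%:E = phi i (X i w) by rewrite /g/= fineK.
have gfin i : \int[P]_w (g i (X i w, Y i w))%:E < +oo.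
  rewrite (eq_integral (fun w => phi i (X i w))) => [|w _]; last by rewrite gE.
  by have := phiE i _ measurableT; rewrite preimage_setT => ->.
pose h w := (\prod_(i < n) G (X i w, Y i w))%R.
pose k w := (\prod_(i < n) g i (X i w, Y i w))%R.
have mh : measurable_fun setT h.
  by apply: measurable_prodr.
have mk : measurable_fun setT k.
  by apply: measurable_prodr => i; exact: (measurableT_comp (mg i) (mZ i)).
have h0 w : (0 <= h w)%R by apply: prodr_ge0.
have k0 w : (0 <= k w)%R by apply: prodr_ge0.
have mVB : measurable (V @^-1` B).
  by rewrite -[X in measurable X]setTI; exact: measurable_tuple_of.
have -> : \int[P]_(w in V @^-1` B) (h w)%:E = \int[P]_(w in V @^-1` B) (k w)%:E.
  apply: (eq_integral_tuple P h k n V mh h0 mk k0 measurable_tuple_of) => //.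
    rewrite (_ : [set: Omega] = [set w | forall i : 'I_n, [set: T1] (tnth (V w) i)]).
      rewrite [ltLHS](integral_rectangle (fun=> G) (fun=> [set: T1]))//.
      rewrite ltey_eq prode_fin_num// => i _.
      rewrite preimage_setT ge0_fin_numE//.
      by apply: integral_ge0 => w _; rewrite lee_fin.
    by apply/seteqP; split.
  move=> A mA /=.
  rewrite (integral_rectangle (fun=> G))// (integral_rectangle g)//.
  apply: eq_bigr => i _; rewrite -phiE//.
  by apply: eq_integral => w _; rewrite gE.
rewrite -[leRHS]mul1e -(integral_cst P mVB 1).
apply: ae_ge0_le_integral => //.
- by move=> w _; rewrite lee_fin.
- by apply: (measurable_funS measurableT) => //; exact/measurable_EFinP.
have : {ae P, forall w, forall i, phi i (X i w) <= 1%:E}.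
  exact: filter_forall.
apply: filterS => w phiw _; rewrite lee_fin; apply: prodr_ile1 => i _.
by rewrite g0/= -lee_fin gE phiw.
Qed.

End design_conditioning.

Section model_consequences.
Context {R : realType} {d : nat} {dO : measure_display}.
Context {Omega : measurableType dO} (P : probability Omega R).
Variables (f0 : 'rV[R]_d -> R) (sigma b_eps : R).
Variables (X : nat -> {RV P >-> 'rV[R]_d}) (Y eps : nat -> {RV P >-> R}).
Hypothesis model : regression_model f0 sigma b_eps X Y eps.

Local Open Scope ereal_scope.

Let mXA i A : measurable A -> measurable (X i @^-1` A).
Proof. by move=> mA; rewrite -[X in measurable X]setTI; exact: measurable_funPT. Qed.

(** The model bounds the exponential moments for t > 0 only; negative t come from the conditional
    symmetry of the noise. *)
Lemma model_subgaussian_given i : subgaussian_given P (X i) (eps i) (b_eps ^+ 2).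
Proof.
have mX : measurable_fun setT (X i) by exact: measurable_funPT.
have me : measurable_fun setT (eps i) by exact: measurable_funPT.
have mexp t : measurable_fun setT (fun w => expR (t * eps i w)).
  apply: (measurableT_comp (continuous_measurable_fun (@continuous_expR R))).
  exact: measurable_funM.
suff H t A : measurable A -> \int[P]_(w in X i @^-1` A) (expR (t * eps i w))%:E <=
    (expR (b_eps ^+ 2 * t ^+ 2 / 2))%:E * P (X i @^-1` A).
  move=> t A mA; have mXA' := mXA i _ mA.
  under eq_integral do rewrite expRD mulrC EFinM.
  rewrite ge0_integralZl ?lee_fin ?expR_ge0//; last first.
    by apply: (measurable_funS measurableT) => //; exact/measurable_EFinP.
  apply: le_trans (lee_wpmul2l _ (H t A mA)) _; first by rewrite lee_fin expR_ge0.
  by rewrite muleA -EFinM -expRD addNr expR0 mul1e.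
have pos (t' : R) A' : (0 < t')%R -> measurable A' ->
    \int[P]_(w in X i @^-1` A') (expR (t' * eps i w))%:E <=
    (expR (b_eps ^+ 2 * t' ^+ 2 / 2))%:E * P (X i @^-1` A').
  move=> t0 mA; have mXA' := mXA i _ mA.
  have Hae := model_subgaussian model i t0.
  have [mphi phi0 phiE] := ae_fin_cond_expectation_version _ _ _ (cst _) Hae.
  rewrite -phiE// -integral_cst//.
  apply: ae_ge0_le_integral => //.
  - by apply: (measurable_funS measurableT) => //; exact: measurableT_comp.
  - by move=> w _; rewrite lee_fin expR_ge0.
  - by apply: filterS Hae => w + _.
move=> mA; have mXA' := mXA i _ mA; have [t0|t0|->] := ltgtP t 0%R; [|exact: pos|]; last first.
  rewrite expr0n/= mulr0 mul0r expR0 -integral_cst//.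
  by rewrite le_eqVlt; apply/orP; left; apply/eqP; apply: eq_integral => w _;
    rewrite mul0r expR0.
have mN : measurable_fun setT (fun w => - eps i w)%R.
  exact: measurable_funN.
have meB' B : measurable B -> measurable (eps i @^-1` B).
  by move=> mB; rewrite -[X in measurable X]setTI; exact: me.
have mNB' B : measurable B -> measurable ((fun w => - eps i w)%R @^-1` B).
  by move=> mB; rewrite -[X in measurable X]setTI; exact: mN.
have mI : measurable_fun setT (\1_(X i @^-1` A) : Omega -> R).
  by apply: measurable_indic; exact: mXA.
have I0 w : (0 <= \1_(X i @^-1` A) w :> R)%R by [].
(* The laws of [eps i] and [- eps i] on the event that [X i] is in A. Symmetry identifies them,
   which turns a negative t into -t. *)
pose nu1 := density_measure P _ _ mI I0 me.
pose nu2 := density_measure P _ _ mI I0 mN.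
have nu12 B : measurable B -> nu1 B = nu2 B.
  move=> mB; rewrite /nu1 /nu2 /density_measure.
  have meB := meB' _ mB; have mNB := mNB' _ mB.
  (* Indicators are integrable, so the values compared in the symmetry hypothesis are true versions
     and can be integrated over the event. *)
  have vers (S : set Omega) : measurable S -> cond_expectation_version P (X i)
      (fun w => (\1_S w)%:E) (cond_expectation P (X i) (fun w => (\1_S w)%:E)).
    move=> mS; apply: cond_expectationP.
    have m1 : measurable_fun setT (\1_S : Omega -> R) by exact: measurable_indic.
    have S0 w : (0 <= \1_S w :> R)%R by [].
    have Sfin : \int[P]_w (\1_S w)%:E < +oo.
      by rewrite integral_indic// setIT (le_lt_trans (probability_le1 P _))// ltry.
    have [phi _ ?] := cond_expectation_exists P (X i) _ mX m1 S0 Sfin.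
    by exists phi.
  have swap (S : set Omega) : measurable S ->
      \int[P]_(w in S) (\1_(X i @^-1` A) w)%:E =
      \int[P]_(w in X i @^-1` A) (\1_S w)%:E.
    by move=> mS; rewrite !integral_indic// setIC.
  rewrite !swap//.
  have [m1 p1 e1] := vers _ meB; have [m2 p2 e2] := vers _ mNB.
  rewrite -(e1 A mA) -(e2 A mA).
  apply: ae_eq_integral => //.
  - by apply: (measurable_funS measurableT) => //; exact: measurableT_comp.
  - by apply: (measurable_funS measurableT) => //; exact: measurableT_comp.
  - by have := model_symmetric model i mB; apply: filterS => w + _.
have mE s : measurable_fun setT (fun x : R => (expR (s * x))%:E).
  apply/measurable_EFinP.
  apply: (measurableT_comp (continuous_measurable_fun (@continuous_expR R))).
  exact: measurable_funM.
have E0 s (x : R) : 0 <= (expR (s * x))%:E by rewrite lee_fin expR_ge0.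
have -> : \int[P]_(w in X i @^-1` A) (expR (t * eps i w))%:E =
          \int[nu1]_x (expR (t * x))%:E.
  rewrite (integral_density_measure P _ _ mI I0 me)// [LHS]integral_mkcond.
  by apply: eq_integral => w _; rewrite epatch_indic muleC.
rewrite (eq_measure_integral nu2) => [|B mB _]; last exact: nu12.
rewrite (integral_density_measure P _ _ mI I0 mN)//.
have Nt : (0 < - t)%R by rewrite oppr_gt0.
have := pos _ _ Nt mA; rewrite sqrrN; apply: le_trans.
rewrite le_eqVlt; apply/orP; left; apply/eqP; rewrite [RHS]integral_mkcond.
apply: eq_integral => w _.
by rewrite epatch_indic muleC mulrN mulNr.
Qed.

End model_consequences.

(** * Chaining *)

Section real_lemmas.
Context {R : realType}.
Implicit Types (x y t A B rho : R).

Lemma ler_powR_base (r x y : R) : 0 <= r -> 0 <= x -> x <= y -> x `^ r <= y `^ r.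
Proof.
move=> r0 x0 xy; apply: ge0_ler_powR => //; rewrite ?nnegrE//.
exact: le_trans xy.
Qed.

Lemma sqr_norm_le x y : `|x| <= y -> x ^+ 2 <= y ^+ 2.
Proof.
move=> xy; rewrite -(real_normK (num_real x)).
by rewrite ler_pXn2r// nnegrE// (le_trans _ xy).
Qed.

Lemma sqr_le_close (x y s : R) : `|x - y| <= s -> y ^+ 2 <= 2 * x ^+ 2 + 2 * s ^+ 2.
Proof.
move=> /sqr_norm_le h; apply: le_trans (_ : _ <= 2 * x ^+ 2 + 2 * (x - y) ^+ 2) _.
  rewrite -subr_ge0 [leRHS](_ : _ = (2 * x - y) ^+ 2) ?sqr_ge0//; ring.
by rewrite lerD2l ler_pM2l.
Qed.

Lemma lt_pow2 x : exists k, x < 2 ^+ k.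
Proof.
exists (Num.truncn x).+1; apply: (@lt_trans _ _ (Num.truncn x).+1%:R).
  exact: truncnS_gt.
by rewrite -natrX ltr_nat ltn_expl.
Qed.

(** Either [A * t ^ rho] is at most t / 2 and is absorbed on the left, or t^(1 - rho) is at most
    2A. *)
Lemma powR_self_bound t A B rho : 0 <= t -> 0 <= A -> 0 <= B -> rho < 1 ->
  t <= A * t `^ rho + B -> t <= 2 * B + (2 * A) `^ (1 - rho)^-1.
Proof.
move=> t0 A0 B0 rho1 H.
have p0 : 0 <= (2 * A) `^ (1 - rho)^-1 by exact: powR_ge0.
have [->|tn0] := eqVneq t 0; first by rewrite addr_ge0// mulr_ge0.
have tgt : 0 < t by rewrite lt0r tn0.
have r1 : 0 < 1 - rho by rewrite subr_gt0.
have [h|h] := leP (2 * A * t `^ rho) t.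
  rewrite -[leLHS]addr0 lerD//.
  move: H h; set s := t `^ rho => H h; nra.
suff : t <= (2 * A) `^ (1 - rho)^-1.
  by move=> /le_trans; apply; rewrite lerDr mulr_ge0.
have tr : 0 < t `^ rho by exact: powR_gt0.
have : t `^ (1 - rho) <= 2 * A.
  rewrite powRB ?powRr1 ?(ltW tgt)//; last by apply/implyP.
  by rewrite ler_pdivrMr// ltW.
move=> h2; have -> : t = (t `^ (1 - rho)) `^ (1 - rho)^-1.
  by rewrite -powRrM mulfV ?gt_eqF// powRr1// ltW.
by apply: ler_powR_base => //; [rewrite invr_ge0 ltW|exact: powR_ge0].
Qed.

(** This is what makes a bound on the mean of W sufficient: powers of the logarithm produced by the
    mixture are absorbed linearly. *)
Lemma powR_log_bound (p z0 z1 : R) : 0 < p -> 0 <= z0 -> 0 < z1 ->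
  exists2 C, 0 <= C & forall w, 0 <= w -> (z0 + z1 * ln (1 + w)) `^ p <= C * (1 + w).
Proof.
move=> p0 z00 z10.
(* From y <= exp(q y) / q; this q makes exp(q y)^p equal to exp(z0 / z1) (1 + w). *)
pose q := (z1 * p)^-1.
have q0 : 0 < q by rewrite invr_gt0 mulr_gt0.
exists (q^-1 `^ p * expR (z0 / z1)).
  by rewrite mulr_ge0 ?powR_ge0 ?expR_ge0.
move=> w w0; set y := z0 + _.
have w1 : 0 < 1 + w by rewrite ltr_wpDr.
have y0 : 0 <= y by rewrite addr_ge0// mulr_ge0 ?ln_ge0 ?lerDl// ltW.
have -> : q^-1 `^ p * expR (z0 / z1) * (1 + w) = q^-1 `^ p * (expR (q * y)) `^ p.
  rewrite -mulrA; congr (_ * _).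
  rewrite -expRM -[X in _ * X](lnK w1) -expRD; congr expR.
  by rewrite /q /y; field; rewrite !gt_eqF.
rewrite -powRM ?expR_ge0//; last by rewrite invr_ge0 ltW.
apply: ler_powR_base => //; first exact: ltW.
rewrite -(ler_pM2l q0) mulrA mulfV ?gt_eqF// mul1r.
by apply: le_trans (expR_ge1Dx _); rewrite lerDr.
Qed.

Lemma powRD3_le (alpha x y z : R) : 0 < alpha -> 0 <= x -> 0 <= y -> 0 <= z ->
  (x + y + z) `^ alpha <= 3 `^ alpha * (x `^ alpha + y `^ alpha + z `^ alpha).
Proof.
move=> a0 x0 y0 z0; set m := Num.max x (Num.max y z).
have xm : x <= m by rewrite le_max lexx.
have ym : y <= m by rewrite !le_max lexx orbT.
have zm : z <= m by rewrite !le_max lexx !orbT.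
have m0 : 0 <= m by exact: le_trans xm.
apply: (@le_trans _ _ ((3 * m) `^ alpha)).
  apply: ler_powR_base; [exact: ltW|by rewrite !addr_ge0|lra].
rewrite powRM// ler_wpM2l ?powR_ge0//.
have xa := powR_ge0 x alpha; have ya := powR_ge0 y alpha; have za := powR_ge0 z alpha.
by rewrite /m /Num.max; do ?case: ifP => _; lra.
Qed.

End real_lemmas.

Section chaining.
Context {R : realType}.
Variables (n : nat) (e : 'I_n -> R).
Implicit Types (u g : 'I_n -> R).

Definition emp_noise u : R := (Num.sqrt n%:R)^-1 * \sum_(i < n) e i * u i.

Definition emp_sq u : R := n%:R^-1 * \sum_(i < n) u i ^+ 2.

Lemma emp_sq_ge0 u : 0 <= emp_sq u.
Proof. by rewrite mulr_ge0// sumr_ge0// => i _; exact: sqr_ge0. Qed.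

Lemma emp_sq_le u (c : R) : (0 < n)%N -> (forall i, u i ^+ 2 <= c) -> emp_sq u <= c.
Proof.
move=> n0 uc; rewrite /emp_sq ler_pdivrMl ?ltr0n//.
apply: (@le_trans _ _ (\sum_(i < n) c)); first exact: ler_sum.
by rewrite sumr_const card_ord mulr_natl.
Qed.

Lemma emp_noiseD u g : emp_noise (fun i => u i + g i) = emp_noise u + emp_noise g.
Proof.
rewrite /emp_noise -mulrDr -big_split/=; congr (_ * _).
by apply: eq_bigr => i _; rewrite mulrDr.
Qed.

Lemma emp_noiseZ (c : R) u : emp_noise (fun i => c * u i) = c * emp_noise u.
Proof.
rewrite /emp_noise [RHS]mulrCA; congr (_ * _); rewrite mulr_sumr.
by apply: eq_bigr => i _; rewrite mulrCA.
Qed.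

Lemma emp_sqZ (c : R) u : emp_sq (fun i => c * u i) = c ^+ 2 * emp_sq u.
Proof.
rewrite /emp_sq [RHS]mulrCA; congr (_ * _); rewrite mulr_sumr.
by apply: eq_bigr => i _; rewrite exprMn.
Qed.

Lemma emp_noise_le u (c : R) : (forall i, `|u i| <= c) ->
  emp_noise u <= (Num.sqrt n%:R)^-1 * (\sum_(i < n) `|e i|) * c.
Proof.
move=> uc; rewrite -mulrA ler_wpM2l ?invr_ge0 ?sqrtr_ge0// mulr_suml.
apply: ler_sum => i _; apply: le_trans (ler_norm _) _.
by rewrite normrM ler_wpM2l.
Qed.

Variables (K gam Z : R).
Hypotheses (n0 : (0 < n)%N) (K0 : 0 < K) (gam0 : 0 < gam) (Z0 : 0 <= Z).

Definition scale k : R := K / 2 ^+ k.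

Lemma scale_gt0 k : 0 < scale k.
Proof. by rewrite divr_gt0// exprn_gt0. Qed.

Lemma scaleS k : scale k.+1 = scale k / 2.
Proof. by rewrite /scale exprS invfM mulrA mulrAC. Qed.

Let q : R := 2 `^ (- gam).

Let q0 : 0 < q. Proof. by rewrite powR_gt0. Qed.

Let q1 : q < 1.
Proof.
rewrite /q powRN invf_lt1 ?powR_gt0// -[ltLHS](powRr0 2).
have : ln (2 : R) * gam > 0 by rewrite mulr_gt0// ln_gt0// ltr1n.
by rewrite /powR pnatr_eq0/= mul0r expR0 mulrC expR_gt1.
Qed.

Let scale_powS k : scale k.+1 `^ gam = q * scale k `^ gam.
Proof.
rewrite scaleS mulrC powRM ?invr_ge0//; last exact/ltW/scale_gt0.
by rewrite /q powRN -[2^-1]powR_inv1// -powRrM mulN1r powRN.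
Qed.

(** The factor 2^gam pays for rounding the empirical norm up to a dyadic scale; 1 is the starting
    centre, and 1 / (1 - q) the geometric sum of the links. *)
Definition chaining_cst : R := 2 `^ gam * (1 + (1 - q)^-1).

Lemma chaining_cst_ge0 : 0 <= chaining_cst.
Proof.
by rewrite mulr_ge0 ?powR_ge0// addr_ge0// invr_ge0 subr_ge0 ltW.
Qed.

Variables (g : 'I_n -> R) (pi_ : nat -> 'I_n -> R).
Hypothesis gpi : forall k i, `|g i - pi_ k i| <= scale k.
Hypothesis pi_start : forall k, emp_sq (pi_ k) <= 4 * scale k ^+ 2 ->
  emp_noise (pi_ k) <= Z * scale k `^ gam.
Hypothesis pi_step : forall k,
  emp_sq (fun i => pi_ k.+1 i - pi_ k i) <= 4 * scale k ^+ 2 ->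
  emp_noise (fun i => pi_ k.+1 i - pi_ k i) <= Z * scale k `^ gam.

(** The chain starts at scale m, already of the order of the empirical norm of g, and not at the
    coarsest one; this localizes the bound to [scale m ^ gam]. *)
Lemma chaining_scale m : emp_sq g <= scale m ^+ 2 ->
  emp_noise g <= Z * (1 + (1 - q)^-1) * scale m `^ gam.
Proof.
move=> gm.
have q1' : 1 - q != 0 by rewrite subr_eq0 gt_eqF.
have start : emp_noise (pi_ m) <= Z * scale m `^ gam.
  apply: pi_start.
  apply: (@le_trans _ _ (2 * emp_sq g + 2 * scale m ^+ 2)); last by lra.
  have -> : 2 * emp_sq g + 2 * scale m ^+ 2 =
      n%:R^-1 * \sum_(i < n) (2 * g i ^+ 2 + 2 * scale m ^+ 2).
    rewrite big_split/= -mulr_sumr sumr_const card_ord /emp_sq mulrDr.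
    rewrite mulrCA; congr (_ + _); rewrite -[2 * _ *+ n]mulr_natl mulKf//.
    by rewrite pnatr_eq0 -lt0n.
  rewrite /emp_sq ler_wpM2l// ler_sum// => i _.
  exact: sqr_le_close.
have step k : emp_noise (fun i => pi_ k.+1 i - pi_ k i) <= Z * scale k `^ gam.
  apply: pi_step; apply: emp_sq_le => // i.
  have := gpi k i; have := gpi k.+1 i; rewrite scaleS.
  have := ltW (scale_gt0 k); move: (scale k) => s s0.
  rewrite !ler_norml => /andP[h1 h2] /andP[h3 h4].
  have h5 : pi_ k.+1 i - pi_ k i <= 2 * s by lra.
  have h6 : - (2 * s) <= pi_ k.+1 i - pi_ k i by lra.
  nra.
(* The fraction is the exact value of the sum of [scale k ^ gam] over m <= k < m + j, because
   consecutive terms have ratio q. *)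
have ind j : emp_noise (pi_ (m + j)) <= Z * (scale m `^ gam +
    (scale m `^ gam - scale (m + j) `^ gam) / (1 - q)).
  elim: j => [|j IH]; first by rewrite addn0 subrr mul0r addr0.
  rewrite addnS (_ : emp_noise _ = emp_noise (pi_ (m + j)) +
      emp_noise (fun i => pi_ (m + j).+1 i - pi_ (m + j) i)); last first.
    by rewrite -emp_noiseD; congr emp_noise; apply/funext => i; rewrite addrC subrK.
  apply: le_trans (lerD IH (step _)) _.
  rewrite scale_powS le_eqVlt; apply/orP; left; apply/eqP; field.
  exact: q1'.
(* The remainder of the chain needs no probabilistic bound: at a fixed outcome it is at most E times
   the scale, which tends to 0. *)
pose E := (Num.sqrt n%:R)^-1 * (\sum_(i < n) `|e i|).
have E0 : 0 <= E by rewrite mulr_ge0 ?invr_ge0 ?sqrtr_ge0// sumr_ge0.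
apply/ler_addgt0Pr => eps eps0.
have [j Hj] := lt_pow2 (E * K / eps).
have Ej : E * scale (m + j) <= eps.
  rewrite /scale mulrA ler_pdivrMr ?exprn_gt0// [leRHS]mulrC -ler_pdivrMr//.
  apply: le_trans (ltW Hj) _; rewrite ler_eXn2l ?ltr1n// leq_addl//.
rewrite (_ : emp_noise g = emp_noise (pi_ (m + j)) +
    emp_noise (fun i => g i - pi_ (m + j) i)); last first.
  by rewrite -emp_noiseD; congr emp_noise; apply/funext => i; rewrite addrC subrK.
apply: lerD; last exact: le_trans (emp_noise_le _ _ (gpi (m + j))) Ej.
apply: le_trans (ind j) _; rewrite -mulrA ler_wpM2l//.
rewrite [leRHS]mulrDl mul1r lerD2l mulrC ler_wpM2l//.
  by rewrite invr_ge0 subr_ge0 ltW.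
by rewrite lerBlDr lerDl powR_ge0.
Qed.

Lemma chaining_bound : (forall i, `|g i| <= K) ->
  emp_noise g <= chaining_cst * Z * Num.sqrt (emp_sq g) `^ gam.
Proof.
move=> gK; set r := Num.sqrt _.
have r0 : 0 <= r by exact: sqrtr_ge0.
have rE : emp_sq g = r ^+ 2 by rewrite sqr_sqrtr// emp_sq_ge0.
have [r00|rn0] := eqVneq r 0.
  have g0 i : g i = 0.
    move: rE; rewrite r00 expr0n/= => /eqP.
    rewrite mulf_eq0 invr_eq0 pnatr_eq0 eqn0Ngt n0/=.
    rewrite psumr_eq0 => [/allP/(_ i)|j _]; last exact: sqr_ge0.
    by rewrite mem_index_enum => /(_ isT); rewrite /= sqrf_eq0 => /eqP.
  rewrite /emp_noise big1 ?mulr0; last by move=> i _; rewrite g0 mulr0.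
  by apply: mulr_ge0 (powR_ge0 _ _); apply: mulr_ge0 => //; exact: chaining_cst_ge0.
have rgt : 0 < r by rewrite lt0r rn0.
have rK : r <= K.
  rewrite -(ler_pXn2r (ltn0Sn 1)) ?nnegrE ?(ltW K0)// -rE.
  by apply: emp_sq_le => // i; exact: sqr_norm_le.
(* The first scale below r has positive index because r <= K; its predecessor m satisfies r <= scale
   m < 2 r. *)
have Hex : exists k, scale k < r.
  have [k Hk] := lt_pow2 (K / r); exists k.
  by rewrite /scale ltr_pdivrMr ?exprn_gt0// mulrC -ltr_pdivrMr.
case: (ex_minnP Hex) => -[|m] Hm mmin.
  by move: Hm; rewrite /scale expr0 divr1 ltNge rK.
have rm : r <= scale m.
  by rewrite leNgt; apply/negP => /mmin; rewrite ltnn.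
have := @chaining_scale m; rewrite rE ler_pXn2r ?nnegrE ?(ltW (scale_gt0 m))//.
move=> /(_ rm) /le_trans; apply.
rewrite /chaining_cst [leRHS](_ : _ = Z * (1 + (1 - q)^-1) * (2 * r) `^ gam).
  rewrite ler_wpM2l//.
    by rewrite mulr_ge0// addr_ge0// invr_ge0 subr_ge0 ltW.
  apply: ler_powR_base; [exact: ltW|exact/ltW/scale_gt0|].
  by move: Hm; rewrite scaleS; lra.
by rewrite powRM//; ring.
Qed.

End chaining.

(** * Solving the basic inequality *)

Section penalized_rate.
Context {R : realType}.
Variables (a beta alpha : R).
Hypotheses (a_gt0 : 0 < a) (beta_gt0 : 0 < beta) (beta_lt2 : beta < 2).
Hypothesis alpha_gt : 2 * beta / (beta + 2) < alpha.

Lemma alpha_gt0 : 0 < alpha.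
Proof. by apply: lt_trans alpha_gt; rewrite divr_gt0 ?mulr_gt0 ?addr_gt0. Qed.

Lemma rate_exponent_lt1 : (2 - beta) / 4 + beta / (2 * alpha) < 1.
Proof.
have a0 := alpha_gt0.
have b2 : 0 < beta + 2 by rewrite addr_gt0.
move: alpha_gt; rewrite ltr_pdivrMr// => H.
rewrite -ltrBrDl ltr_pdivrMr ?mulr_gt0//; nra.
Qed.

Lemma rate_of_basic_inequality (A z0 z1 : R) : 0 <= A -> 0 <= z0 -> 0 < z1 ->
  exists2 C, 0 <= C & forall (n : nat) (r I I0 w : R), (0 < n)%N ->
    0 <= r -> 0 <= I -> 0 <= I0 -> 0 <= w ->
    let h := a * n%:R `^ (- 1 / (2 + beta)) in
    r ^+ 2 + h ^+ 2 * I `^ alpha <=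
      2 * (Num.sqrt n%:R)^-1 *
        (A * (z0 + z1 * ln (1 + w)) * (I + I0 + 1) `^ (beta / 2) *
          r `^ (1 - beta / 2)) + h ^+ 2 * I0 `^ alpha ->
    r ^+ 2 + h ^+ 2 * (I + I0 + 1) `^ alpha <=
      C * n%:R `^ (- 2 / (2 + beta)) * (1 + I0 `^ alpha + w).
Proof.
move=> A0 z00 z10.
have al0 := alpha_gt0; have rho1 := rate_exponent_lt1.
set rho := _ + _ in rho1.
have b2 : 0 < 2 + beta by rewrite addr_gt0.
have p0 : 0 < (1 - rho)^-1 by rewrite invr_gt0 subr_gt0.
have [C C0 HC] := powR_log_bound _ _ _ p0 z00 z10.
pose c3 : R := 3 `^ alpha.
have c30 : 0 < c3 by exact: powR_gt0.
have c31 : 1 <= c3.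
  by have := ler_powR_base alpha 1 3 (ltW al0) ler01; rewrite powR1; apply; rewrite ler1n.
pose L : R := 2 * A * a `^ (- ((2 + beta) / 2)) * c3 `^ (beta / (2 * alpha)).
have L0 : 0 <= L by rewrite !mulr_ge0 ?powR_ge0.
pose C' : R := c3 * (4 + (2 * L) `^ (1 - rho)^-1 * C).
exists (a ^+ 2 * C').
  apply: mulr_ge0; first exact: sqr_ge0.
  apply: mulr_ge0; first exact: ltW.
  by rewrite addr_ge0// mulr_ge0// powR_ge0.
move=> n r I I0 w n0 r0 I_0 I00 w0 h H.
have nR : (0 : R) < n%:R by rewrite ltr0n.
have h0 : 0 < h by rewrite mulr_gt0 ?powR_gt0.
have h2E : h ^+ 2 = a ^+ 2 * n%:R `^ (- 2 / (2 + beta)).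
  rewrite exprMn -[X in _ * X]powR_mulrn ?powR_ge0// -powRrM; congr (_ * _ `^ _).
  by field; rewrite gt_eqF.
(* The choice of h enters here: n^(-1/2) is a constant times h^((2 + beta)/2), which, with the
   factor h^(1 - beta/2) from the empirical norm, makes the noise term a multiple of h^2. *)
have sqrtE : (Num.sqrt n%:R)^-1 = a `^ (- ((2 + beta) / 2)) * h `^ ((2 + beta) / 2).
  rewrite powRM ?powR_ge0 ?(ltW a_gt0)// mulrA -powRD; last first.
    by apply/implyP => _; rewrite gt_eqF.
  rewrite addNr powRr0 mul1r -powRrM -powR12_sqrt ?(ltW nR)// -powRN; congr (_ `^ _).
  by field; rewrite gt_eqF.
set J := I + I0 + 1 in H *.
have J0 : 0 <= J by rewrite !addr_ge0.
set Z := z0 + z1 * ln (1 + w) in H.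
have Z0 : 0 <= Z.
  by rewrite addr_ge0// mulr_ge0 ?(ltW z10)// ln_ge0// lerDl.
(* The left-hand side in units of h^2. In these units the basic inequality becomes
   [t <= L * Z * t ^ rho + B], free of n; dividing by c3 = 3^alpha lets J^alpha be replaced by
   I^alpha + I0^alpha + 1. *)
pose t := (r ^+ 2 + h ^+ 2 * J `^ alpha / c3) / h ^+ 2.
have h20 : 0 < h ^+ 2 by rewrite exprn_gt0.
have Ja := powR_ge0 J alpha.
have hJ0 : 0 <= h ^+ 2 * J `^ alpha / c3.
  by apply: divr_ge0 (ltW c30); apply: mulr_ge0; rewrite ?sqr_ge0.
have t0 : 0 <= t by apply: divr_ge0 (ltW h20); apply: addr_ge0; rewrite ?sqr_ge0.
have tE : h ^+ 2 * t = r ^+ 2 + h ^+ 2 * J `^ alpha / c3.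
  by rewrite /t mulrC divfK ?gt_eqF.
have JE : J `^ alpha <= c3 * (I `^ alpha + I0 `^ alpha + 1).
  by have := powRD3_le alpha I I0 1 al0 I_0 I00 ler01; rewrite powR1.
have rt : r <= h * t `^ 2^-1.
  have hs0 : 0 <= h * Num.sqrt t by rewrite mulr_ge0 ?sqrtr_ge0// ltW.
  rewrite powR12_sqrt// -(ler_pXn2r (ltn0Sn 1)) ?nnegrE//.
  by rewrite exprMn sqr_sqrtr// tE lerDl.
have Jt : J `^ alpha <= c3 * t.
  rewrite -(ler_pM2l h20) mulrCA tE mulrDr [X in _ <= _ + X]mulrC divfK ?gt_eqF//.
  by rewrite lerDr mulr_ge0 ?sqr_ge0// ltW.
have rgam : r `^ (1 - beta / 2) <= h `^ (1 - beta / 2) * t `^ ((2 - beta) / 4).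
  have g0 : 0 <= 1 - beta / 2 by rewrite subr_ge0 ler_pdivrMr// mul1r ltW.
  apply: le_trans (ler_powR_base _ _ _ g0 r0 rt) _.
  rewrite powRM ?powR_ge0 ?(ltW h0)// -powRrM.
  by rewrite (_ : 2^-1 * (1 - beta / 2) = (2 - beta) / 4)//; field.
have Jbeta : J `^ (beta / 2) <= c3 `^ (beta / (2 * alpha)) * t `^ (beta / (2 * alpha)).
  rewrite -powRM ?(ltW c30)//.
  rewrite (_ : beta / 2 = alpha * (beta / (2 * alpha))); last first.
    by field; rewrite gt_eqF.
  rewrite powRrM; apply: ler_powR_base => //.
  by apply: divr_ge0; [exact: ltW|apply: mulr_ge0 => //; exact: ltW].
have main : 2 * (Num.sqrt n%:R)^-1 *
    (A * Z * J `^ (beta / 2) * r `^ (1 - beta / 2)) <= h ^+ 2 * (L * Z * t `^ rho).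
  apply: (@le_trans _ _ (2 * (Num.sqrt n%:R)^-1 * (A * Z *
    (c3 `^ (beta / (2 * alpha)) * t `^ (beta / (2 * alpha))) *
    (h `^ (1 - beta / 2) * t `^ ((2 - beta) / 4))))).
    apply: ler_wpM2l; first by rewrite mulr_ge0// invr_ge0 sqrtr_ge0.
    have AZ0 : 0 <= A * Z by rewrite mulr_ge0.
    apply: ler_pM => //; rewrite ?powR_ge0//.
      by rewrite mulr_ge0// powR_ge0.
    by rewrite ler_wpM2l.
  rewrite sqrtE.
  have -> : t `^ rho = t `^ ((2 - beta) / 4) * t `^ (beta / (2 * alpha)).
    have rho0 : 0 < rho.
      by rewrite addr_gt0// divr_gt0 ?mulr_gt0// subr_gt0.
    rewrite /rho powRD//; apply/implyP => /eqP rho00.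
    by move: rho0; rewrite /rho rho00 ltxx.
  have -> : h ^+ 2 = h `^ ((2 + beta) / 2) * h `^ (1 - beta / 2).
    rewrite -powRD ?(gt_eqF h0) ?implybT//.
    by rewrite -(powR_mulrn 2 (ltW h0)); congr (_ `^ _); field.
  rewrite /L le_eqVlt; apply/orP; left; apply/eqP; ring.
have tB : t <= L * Z * t `^ rho + (2 * I0 `^ alpha + 1).
  rewrite -(ler_pM2l h20) tE mulrDr.
  have : h ^+ 2 * J `^ alpha / c3 <= h ^+ 2 * (I `^ alpha + I0 `^ alpha + 1).
    by rewrite -mulrA ler_wpM2l ?(ltW h20)// ler_pdivrMr// [leRHS]mulrC.
  rewrite (_ : h ^+ 2 * (I `^ alpha + I0 `^ alpha + 1) =
      h ^+ 2 * I `^ alpha + h ^+ 2 * I0 `^ alpha + h ^+ 2); last by ring.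
  rewrite (_ : h ^+ 2 * (2 * I0 `^ alpha + 1) =
      2 * (h ^+ 2 * I0 `^ alpha) + h ^+ 2); last by ring.
  by lra.
have I0a := powR_ge0 I0 alpha.
have LZ0 : 0 <= L * Z by rewrite mulr_ge0.
have B0 : 0 <= 2 * I0 `^ alpha + 1 by lra.
have := powR_self_bound _ _ _ _ t0 LZ0 B0 rho1 tB.
have L20 : 0 <= 2 * L by rewrite mulr_ge0.
rewrite mulrA (@powRM _ _ _ _ L20 Z0) => tle.
have tle2 : t <= 2 * (2 * I0 `^ alpha + 1) + (2 * L) `^ (1 - rho)^-1 * (C * (1 + w)).
  apply: le_trans tle _; rewrite lerD2l ler_wpM2l ?powR_ge0//; exact: HC.
apply: (@le_trans _ _ (c3 * (h ^+ 2 * t))).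
  rewrite tE mulrDr [X in _ <= _ + X]mulrC divfK ?gt_eqF// lerD2r.
  by rewrite ler_peMl ?sqr_ge0.
rewrite h2E.
set N := n%:R `^ _.
have N0 : 0 <= N by exact: powR_ge0.
have -> : c3 * (a ^+ 2 * N * t) = a ^+ 2 * N * (c3 * t) by ring.
have -> : a ^+ 2 * C' * N * (1 + I0 `^ alpha + w) =
    a ^+ 2 * N * (c3 * ((4 + (2 * L) `^ (1 - rho)^-1 * C) * (1 + I0 `^ alpha + w))).
  by rewrite /C'; ring.
apply: ler_wpM2l; first by rewrite mulr_ge0// sqr_ge0.
rewrite ler_pM2l//; apply: le_trans tle2 _.
set u := (2 * L) `^ _; have u0 : 0 <= u by exact: powR_ge0.
have uC : 0 <= u * C by rewrite mulr_ge0.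
rewrite mulrA; move: (u * C) uC => v v0; nra.
Qed.

End penalized_rate.

(** * Covers of the unit ball *)

Section entropy_covers.
Context {R : realType} {d : nat}.
Variables (F : set ('rV[R]_d -> R)) (sn : ('rV[R]_d -> R) -> R).
Hypothesis Fsn : seminormed_function_space F sn.
Variables (D beta : R).
Hypotheses (D0 : 0 < D) (beta0 : 0 < beta).
Hypothesis entropyF : forall delta : R, 0 < delta ->
  (sup_entropy delta (unit_ball F sn) <= (D * delta `^ (- beta))%:E)%E.

Lemma sup_norm_le (f : 'rV[R]_d -> R) (c : R) :
  (sup_norm f <= c%:E)%E -> forall x, cube d x -> `|f x| <= c.
Proof.
move=> fc x cx; rewrite -lee_fin; apply: le_trans fc.
by apply: ereal_sup_ubound; exists x.
Qed.

Lemma entropy_cover (delta : R) : 0 < delta -> exists (k : nat)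
    (c : 'I_k -> 'rV[R]_d -> R),
  [/\ k%:R <= expR (D * delta `^ (- beta)),
    (forall j, {within cube d, continuous (c j)}) &
    forall f, unit_ball F sn f -> exists j, forall x, cube d x ->
      `|f x - c j x| <= delta].
Proof.
move=> delta0; have := entropyF _ delta0; rewrite /sup_entropy.
set N := covering_number _ _ => HN.
have N0 : (0 <= N)%E.
  by apply: le_ereal_inf_tmp => _ [k _ <-]; rewrite lee_fin.
have {}HN : (N <= (expR (D * delta `^ (- beta)))%:E)%E.
  have -> : N = expeR (lne N) by apply/esym/eqP; rewrite lneK_eq.
  by rewrite -[leRHS]/(expeR (D * delta `^ (- beta))%:E) lee_expeR.
have [none|] := pselect (forall k, ~ Defs.covered_by delta (unit_ball F sn) k).
  suff NE : N = +oo%E by move: HN; rewrite NE leye_eq.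
  rewrite /N /covering_number (_ : [set _ | _ in _] = set0) ?ereal_inf0//.
  by rewrite -subset0 => y [k kc _]; exact: (none k kc).
move=> /existsNP[k0 /contrapT k0c].
have Hex : exists k, `[< Defs.covered_by delta (unit_ball F sn) k >].
  by exists k0; apply/asboolP.
case: (ex_minnP Hex) => k /asboolP[c [cc cov]] kmin.
exists k, c; split => //.
  rewrite -lee_fin; apply: le_trans HN.
  apply: le_ereal_inf_tmp => _ [k' /asboolP k'c <-].
  by rewrite lee_fin ler_nat; exact: kmin.
move=> f /cov[j fj]; exists j; exact: sup_norm_le fj.
Qed.

Lemma unit_ballN f : unit_ball F sn f -> unit_ball F sn (fun x => -1 * f x).
Proof.
move=> [Ff f1]; split; first exact: (fspaceZ Fsn).
by rewrite (seminormZ Fsn)// normrN normr1 mul1r.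
Qed.

(** At this radius the entropy bound equals 1/2, which is less than ln 2, so at most one ball is
    needed to cover the unit ball. *)
Definition radius : R := (2 * D) `^ beta^-1.

Lemma radius_gt0 : 0 < radius.
Proof. by rewrite /radius powR_gt0// mulr_gt0. Qed.

Lemma radius_pow : radius `^ beta = 2 * D.
Proof. by rewrite -powRrM mulVf ?gt_eqF// powRr1// mulr_ge0// ltW. Qed.

(** f and -f lie in the same ball, around one common centre, so their distance [2 * |f x|] is at
    most twice the radius. *)
Lemma unit_ball_bounded f x : unit_ball F sn f -> cube d x -> `|f x| <= radius.
Proof.
move=> Bf cx.
have [k [c [kle _ cov]]] := entropy_cover _ radius_gt0.
(* This is exp(1/2) < 2, obtained from 1 - 1/2 < exp(-1/2). *)
have k1 : (k < 2)%N.
  rewrite -(ltr_nat R); apply: le_lt_trans kle _.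
  rewrite powRN radius_pow invfM mulrCA mulfV ?gt_eqF// mulr1.
  rewrite -[ltLHS]invrK invf_plt ?posrE ?invr_gt0 ?expR_gt0// -expRN.
  apply: le_lt_trans (expR_gt1Dx _); last by rewrite oppr_eq0 invr_eq0.
  by rewrite le_eqVlt; apply/orP; left; apply/eqP; field.
have [j Hj] := cov _ Bf; have [j' Hj'] := cov _ (unit_ballN _ Bf).
have jj' : j' = j.
  apply/val_inj => /=; move: (ltn_ord j) (ltn_ord j') => jk j'k.
  rewrite ltnS in k1; move: (leq_trans jk k1) (leq_trans j'k k1).
  by rewrite !ltnS !leqn0 => /eqP -> /eqP ->.
have := Hj x cx; have := Hj' x cx; rewrite jj' mulN1r.
rewrite !ler_norml => /andP[h1 h2] /andP[h3 h4].
by apply/andP; split; lra.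
Qed.

End entropy_covers.

(** * Exponential moments of the regression noise *)

Section regression_noise.
Context {R : realType} {d : nat} {dO : measure_display}.
Context {Omega : measurableType dO} (P : probability Omega R).
Variables (f0 : 'rV[R]_d -> R) (sigma b_eps b : R).
Variables (X : nat -> {RV P >-> 'rV[R]_d}) (Y eps : nat -> {RV P >-> R}).
Hypothesis model : regression_model f0 sigma b_eps X Y eps.
Hypothesis bE : b = sigma * b_eps.
Hypothesis f0c : {within cube d, continuous f0}.
Variable n : nat.

Definition noise_stat (lam : R) (u : 'rV[R]_d -> R) (w : Omega) : R :=
  expR (lam * (\sum_(i < n) sigma * eps i w * u (X i w)) -
    lam ^+ 2 * b ^+ 2 / 2 * \sum_(i < n) u (X i w) ^+ 2).

Let mX i : measurable_fun setT (X i).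
Proof. exact: measurable_funPT. Qed.

Let mY i : measurable_fun setT (Y i).
Proof. exact: measurable_funPT. Qed.

Let Xc i w : cube d (X i w). Proof. exact: (model_cube model). Qed.

Lemma measurable_cube_comp (u : 'rV[R]_d -> R) i :
  {within cube d, continuous u} -> measurable_fun setT (fun w => u (X i w)).
Proof. by move=> cu; exact: (measurable_caratheodory (fun=> u) (X i)). Qed.

Lemma measurable_noise_stat lam u : {within cube d, continuous u} ->
  measurable_fun setT (noise_stat lam u).
Proof.
move=> cu.
have mu i : measurable_fun setT (fun w => u (X i w)) by exact: measurable_cube_comp.
apply: (measurableT_comp (continuous_measurable_fun (@continuous_expR R))).
apply: measurable_funB; apply: measurable_funM => //; apply: measurable_sum => i.
  by apply: measurable_funM => //; apply: measurable_funM.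
exact: measurable_funX.
Qed.

Lemma noise_stat_given_design lam u (B : set (n.-tuple 'rV[R]_d)) :
  {within cube d, continuous u} -> measurable B ->
  (\int[P]_(w in design X n @^-1` B) (noise_stat lam u w)%:E <=
    P (design X n @^-1` B))%E.
Proof.
move=> cu mB.
(* u and f0 are only known to be measurable on the cube; extended by zero they are measurable
   everywhere and unchanged at the design points. *)
pose u' := u \_ (cube d); pose f0' := f0 \_ (cube d).
have mu' : measurable_fun setT u'.
  apply: (measurable_restrictT u measurable_cube).1.
  by apply: measurable_within_continuous => //; exact: measurable_cube.
have mf0' : measurable_fun setT f0'.
  apply: (measurable_restrictT f0 measurable_cube).1.
  by apply: measurable_within_continuous => //; exact: measurable_cube.
have u'E i w : u' (X i w) = u (X i w) by rewrite /u' patchE mem_set.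
have f0'E i w : f0' (X i w) = f0 (X i w) by rewrite /f0' patchE mem_set.
(* The model states independence for the pairs (X, Y), so the noise is recovered as y - f0(x). *)
pose G (z : 'rV[R]_d * R) := expR (lam * u' z.1 * (z.2 - f0' z.1) -
  b ^+ 2 * (lam * u' z.1) ^+ 2 / 2).
have mG : measurable_fun setT G.
  have mu1 : measurable_fun setT (fun z : 'rV[R]_d * R => lam * u' z.1).
    by apply: measurable_funM => //; exact: (measurableT_comp mu').
  have mf1 : measurable_fun setT (fun z : 'rV[R]_d * R => f0' z.1).
    exact: (measurableT_comp mf0').
  apply: (measurableT_comp (continuous_measurable_fun (@continuous_expR R))).
  apply: measurable_funB.
    by apply: measurable_funM => //; apply: measurable_funB.
  apply: measurable_funM => //; apply: measurable_funM => //.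
  exact: measurable_funX.
have GE i w : G (X i w, Y i w) =
    expR (lam * u' (X i w) * (sigma * eps i w) - b ^+ 2 * (lam * u' (X i w)) ^+ 2 / 2).
  by rewrite /G/= f0'E (model_Y model) addrAC subrr add0r.
have indep (A : 'I_n -> set ('rV[R]_d * R)) : (forall i, measurable (A i)) ->
    P [set w | forall i : 'I_n, A i (X i w, Y i w)] =
    (\prod_(i < n) P ((fun w => (X i w, Y i w)) @^-1` A i))%E.
  exact: (independent_family_prefix _ _ _ (model_indep model)).
have HG (i : 'I_n) A : measurable A ->
    (\int[P]_(w in X i @^-1` A) (G (X i w, Y i w))%:E <= P (X i @^-1` A))%E.
  move=> mA; under eq_integral do rewrite GE.
  apply: (subgaussian_given_fun P (X i) (fun w => sigma * eps i w) _ _ (b ^+ 2)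
    (fun x => lam * u' x)) => //.
  - exact: measurable_funM.
  - move=> t A' mA'.
    have := subgaussian_given_scale P (X i) (eps i) _ sigma
      (model_subgaussian_given P f0 sigma b_eps X Y eps model i) t A' mA'.
    by rewrite bE exprMn [b_eps ^+ 2 * _]mulrC.
  - exact: measurable_funM.
have := integral_prod_given_design P n (fun i => X i) (fun i => Y i) (fun i => mX i)
  (fun i => mY i) indep G mG (fun=> expR_ge0 _) HG B mB.
apply: le_trans; rewrite le_eqVlt; apply/orP; left; apply/eqP.
apply: eq_integral => w _; congr EFin.
rewrite (eq_bigr _ (fun (i : 'I_n) _ => GE i w)) -expR_sum /noise_stat; congr expR.
rewrite !mulr_sumr -sumrB; apply: eq_bigr => i _; rewrite u'E; by field.
Qed.

End regression_noise.

Lemma sum_le_double {R : realType} (n1 n2 E1 E2 : R) : 0 <= n1 -> 0 <= n2 ->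
  1 <= E1 -> n1 <= E2 -> n2 <= E1 -> n1 + n2 * n1 <= 2 * (E1 * E2).
Proof.
move=> n10 n20 E11 n1E n2E.
have h1 : n2 * n1 <= E1 * E2 by exact: ler_pM.
have h2 : n1 <= E1 * E2.
  by apply: (le_trans n1E); rewrite ler_peMl// (le_trans n10).
by rewrite mulr_natl mulr2n lerD.
Qed.

(** * Oracle inequality *)

Section oracle_inequality.
Context {R : realType}.
Variables (a beta alpha b D : R).
Hypotheses (a_gt0 : 0 < a) (beta_gt0 : 0 < beta) (beta_lt2 : beta < 2).
Hypothesis alpha_gt : 2 * beta / (beta + 2) < alpha.
Hypothesis D_gt0 : 0 < D.

Let K := radius D beta.

Let K0 : 0 < K. Proof. exact: radius_gt0. Qed.

Let gam : R := 1 - beta / 2.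

Let gam0 : 0 < gam.
Proof. by rewrite subr_gt0 ltr_pdivrMr// mul1r. Qed.

Let delta k : R := scale K k.

Let delta_gt0 k : 0 < delta k. Proof. exact: scale_gt0. Qed.

(** The entropy at scale k, up to the factor D. *)
Let x_ k : R := delta k `^ (- beta).

Let x_gt0 k : 0 < x_ k. Proof. by rewrite powR_gt0. Qed.

Let xS k : x_ k.+1 <= 4 * x_ k.
Proof.
have s0 : 0 <= scale K k := ltW (delta_gt0 k).
rewrite /x_ /delta scaleS powRM// mulrC.
rewrite ler_wpM2r ?powR_ge0// -[2^-1]powR_inv1// -powRrM mulN1r opprK.
rewrite (_ : 4 = 2 `^ 2%:R); first by rewrite ler_powR ?ler1n// ltW.
by rewrite powR_mulrn//; ring.
Qed.

(** The weights 2^(-(k+1)) cost a term linear in k, whereas [x_ k] grows like 2^(beta k); exp(x) >=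
    1 + x compares the two. *)
Let x_linear k : k.+2%:R <= (2 + (beta * ln 2)^-1) * K `^ beta * x_ k.
Proof.
have l2 : 0 < ln (2 : R) by rewrite ln_gt0// ltr1n.
have bl : 0 < beta * ln 2 by rewrite mulr_gt0.
have -> : (2 + (beta * ln 2)^-1) * K `^ beta * x_ k =
    (2 + (beta * ln 2)^-1) * expR (k%:R * (beta * ln 2)).
  rewrite -mulrA; congr (_ * _).
  rewrite /x_ /delta /scale powRM ?invr_ge0 ?exprn_ge0 ?(ltW K0)// mulrA.
  have Kb : K `^ beta != 0 by rewrite gt_eqF// powR_gt0.
  rewrite [K `^ (- _)]powRN mulVKf//.
  rewrite -powR_invn// -powRrM mulrNN /powR pnatr_eq0/=.
  by congr expR; ring.
apply: (@le_trans _ _ ((2 + (beta * ln 2)^-1) * (1 + k%:R * (beta * ln 2)))); last first.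
  by rewrite ler_wpM2l ?expR_ge1Dx// addr_ge0// invr_ge0 ltW.
have -> : (2 + (beta * ln 2)^-1) * (1 + k%:R * (beta * ln 2)) =
    2 + k%:R + (beta * ln 2)^-1 + 2 * k%:R * (beta * ln 2).
  by field; rewrite gt_eqF ?gt_eqF.
have -> : k.+2%:R = 2 + k%:R :> R by rewrite -(addn2 k) natrD addrC.
rewrite -[leRHS]addrA lerDl.
have bl0 := ltW bl; apply: addr_ge0; first by rewrite invr_ge0.
by rewrite mulr_ge0// mulr_ge0.
Qed.

(** 5 D = D + 4 D accounts for the covers at scales k and k + 1, and the last summand for the weight
    of scale k. *)
Let c0 : R := 5 * D + (2 + (beta * ln 2)^-1) * K `^ beta.

Let c0_ge0 : 0 <= c0.
Proof.
have l2 : 0 < ln (2 : R) by rewrite ln_gt0// ltr1n.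
have D0 := ltW D_gt0; have b0 := ltW beta_gt0.
by rewrite addr_ge0 ?mulr_ge0// ?powR_ge0// addr_ge0// invr_ge0 mulr_ge0// ltW.
Qed.

(* The cardinality of the k-th family of centres and increments, weighted by
   its mixture weight, is absorbed in the entropy at scale k. *)
Let family_weight k (N N' : nat) :
  N%:R <= expR (D * x_ k) -> N'%:R <= expR (D * x_ k.+1) ->
  2 ^+ k.+1 * (N + N' * N)%:R <= expR (c0 * x_ k).
Proof.
move=> HN HN'.
have N'4 : N'%:R <= expR (4 * D * x_ k).
  apply: le_trans HN' _; rewrite ler_expR [4 * D]mulrC -[leRHS]mulrA.
  by rewrite ler_pM2l//; exact: xS.
have e1 : 1 <= expR (4 * D * x_ k).
  by rewrite -expR0 ler_expR mulr_ge0 ?mulr_ge0 ?(ltW D_gt0) ?(ltW (x_gt0 k)).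
have N0 : (0 : R) <= N%:R by [].
have N'0 : (0 : R) <= N'%:R by [].
have NN : (N + N' * N)%:R <= 2 * expR (5 * D * x_ k).
  have -> : expR (5 * D * x_ k) = expR (4 * D * x_ k) * expR (D * x_ k).
    by rewrite -expRD; congr expR; ring.
  have := @sum_le_double _ _ _ _ _ N0 N'0 e1 HN N'4.
  by rewrite -natrM -natrD.
have p2 : 2 ^+ k.+2 <= expR ((2 + (beta * ln 2)^-1) * K `^ beta * x_ k).
  apply: le_trans (_ : _ <= expR (k.+2%:R)) _; last by rewrite ler_expR.
  rewrite -[k.+2%:R]mul1r expRM_natr ler_pXn2r ?nnegrE ?expR_ge0//.
  by apply: le_trans (expR_ge1Dx _); rewrite -mulr2n.
apply: (@le_trans _ _ (2 ^+ k.+2 * expR (5 * D * x_ k))).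
  by rewrite [2 ^+ k.+2]exprSr -mulrA ler_wpM2l// exprn_ge0.
have -> : c0 * x_ k =
    (2 + (beta * ln 2)^-1) * K `^ beta * x_ k + 5 * D * x_ k by rewrite /c0; ring.
by rewrite expRD; apply: ler_wpM2r; [exact: expR_ge0|exact: p2].
Qed.

(** [2 * b ^+ 2] is the variance term at empirical norm 2 [delta k], and [c0] the price of
    extraction, both relative to [x_ k]. As [delta k <= K], the product [z1 * x_ k] is at least 1,
    so ln(1 + w) can carry the same factor. *)
Let z0 : R := 2 * b ^+ 2 + c0.
Let z1 : R := K `^ beta.

Let z0_ge0 : 0 <= z0. Proof. by rewrite addr_ge0// mulr_ge0 ?sqr_ge0. Qed.
Let z1_gt0 : 0 < z1. Proof. by rewrite powR_gt0. Qed.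

(** This exponent gives [lam k ^+ 2 * delta k ^+ 2 = x_ k], so variance balances entropy, and
    [x_ k / lam k] is [delta k] to the power gam. *)
Let lam k : R := delta k `^ (- (1 + beta / 2)).

Let noise_le (n k : nat) (e u : 'I_n -> R) (M w : R) : (0 < n)%N -> 0 <= w ->
  M <= expR (c0 * x_ k) ->
  expR (lam k / Num.sqrt n%:R * (\sum_(i < n) e i * u i) -
    (lam k / Num.sqrt n%:R) ^+ 2 * b ^+ 2 / 2 * \sum_(i < n) u i ^+ 2) <= M * w ->
  emp_sq n u <= 4 * delta k ^+ 2 ->
  emp_noise n e u <= (z0 + z1 * ln (1 + w)) * delta k `^ gam.
Proof.
move=> n0 w0 Mle H usq.
have nR : (0 : R) < n%:R by rewrite ltr0n.
have w1 : 0 < 1 + w by rewrite ltr_wpDr.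
have lam0 : 0 < lam k by rewrite powR_gt0.
have dk := delta_gt0 k.
have E1 : lam k / Num.sqrt n%:R * (\sum_(i < n) e i * u i) = lam k * emp_noise n e u.
  by rewrite /emp_noise mulrA.
have E2 : (lam k / Num.sqrt n%:R) ^+ 2 * b ^+ 2 / 2 * \sum_(i < n) u i ^+ 2 =
    lam k ^+ 2 * b ^+ 2 / 2 * emp_sq n u.
  rewrite /emp_sq expr_div_n sqr_sqrtr ?(ltW nR)//; by field; rewrite gt_eqF.
rewrite E1 E2 in H.
have H1 : lam k * emp_noise n e u - lam k ^+ 2 * b ^+ 2 / 2 * emp_sq n u <=
    c0 * x_ k + ln (1 + w).
  rewrite -ler_expR [leRHS]expRD lnK ?posrE//; apply: le_trans H _.
  apply: (@le_trans _ _ (expR (c0 * x_ k) * w)); first by rewrite ler_wpM2r.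
  by rewrite ler_wpM2l ?expR_ge0// lerDr.
have xlam : lam k ^+ 2 * delta k ^+ 2 = x_ k.
  rewrite /lam /x_ -exprMn -[X in (_ * X) ^+ 2]powRr1 ?(ltW dk)//.
  rewrite -powRD ?(gt_eqF dk) ?implybT// -powR_mulrn ?powR_ge0// -powRrM.
  by congr (_ `^ _); field.
have H2 : lam k ^+ 2 * b ^+ 2 / 2 * emp_sq n u <= 2 * b ^+ 2 * x_ k.
  apply: (@le_trans _ _ (lam k ^+ 2 * b ^+ 2 / 2 * (4 * delta k ^+ 2))).
    by rewrite ler_wpM2l// divr_ge0// mulr_ge0 ?sqr_ge0.
  by rewrite -xlam le_eqVlt; apply/orP; left; apply/eqP; field.
have H3 : lam k * emp_noise n e u <= z0 * x_ k + ln (1 + w).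
  by rewrite /z0 mulrDl; lra.
have l0 : 0 <= ln (1 + w) by rewrite ln_ge0// lerDl.
rewrite -(ler_pM2l lam0); apply: le_trans H3 _.
have xg : lam k * delta k `^ gam = x_ k.
  rewrite /lam /x_ -powRD ?(gt_eqF dk) ?implybT//.
  by congr (_ `^ _); rewrite /gam; field.
rewrite [leRHS]mulrCA xg [leRHS]mulrDl lerD2l [leRHS](_ : _ = ln (1 + w) * (z1 * x_ k)); last by ring.
rewrite ler_peMr//.
rewrite /z1 /x_ powRN ler_pdivlMr ?powR_gt0// mul1r ler_powR_base ?(ltW beta_gt0)//.
  exact: ltW.
by rewrite /delta /scale ler_pdivrMr ?exprn_gt0// ler_peMr ?(ltW K0)// exprn_ege1// ler1n.
Qed.

Lemma oracle_inequality : exists2 C, 0 < C &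
  forall (d : nat) (F : set ('rV[R]_d -> R)) (sn : ('rV[R]_d -> R) -> R),
  seminormed_function_space F sn ->
  (forall delta : R, 0 < delta ->
    (sup_entropy delta (unit_ball F sn) <= (D * delta `^ (- beta))%:E)%E) ->
  forall (dO : measure_display) (Omega : measurableType dO)
    (P : probability Omega R) (f0 : 'rV[R]_d -> R) (sigma b_eps : R)
    (X : nat -> {RV P >-> 'rV[R]_d}) (Y eps : nat -> {RV P >-> R}),
  regression_model f0 sigma b_eps X Y eps ->
  b = sigma * b_eps -> F f0 -> forall (n : nat), (0 < n)%N ->
  exists W : Omega -> \bar R, [/\ measurable_fun setT W, forall w, (0 <= W w)%E,
    forall B, measurable B ->
      (\int[P]_(w in design X n @^-1` B) W w <= P (design X n @^-1` B))%E &
    forall w f,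
      let h := a * n%:R `^ (- 1 / (2 + beta)) in
      penalized_erm h alpha F sn (sample X Y n w) f ->
      ((empirical_norm2 (design X n w) (fun x => f x - f0 x) +
        h ^+ 2 * (sn f + sn f0 + 1) `^ alpha)%:E <=
       (C * n%:R `^ (- 2 / (2 + beta)))%:E * ((1 + sn f0 `^ alpha)%:E + W w))%E].
Proof.
have A0 := chaining_cst_ge0 gam gam0.
have [C C0 HC] := rate_of_basic_inequality a beta alpha a_gt0 beta_gt0 beta_lt2
  alpha_gt _ _ _ A0 z0_ge0 z1_gt0.
(* A strictly positive constant makes the right-hand side infinite where [W w] is +oo. *)
exists (C + 1); first by rewrite ltr_wpDl.
move=> d F sn Fsn entF dO Omega P f0 sigma b_eps X Y eps model bE Ff0 n n0.
have f0c := fspace_continuous Fsn Ff0.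
have nR : (0 : R) < n%:R by rewrite ltr0n.
have Hex k : exists N : nat, exists c : 'I_N -> 'rV[R]_d -> R,
    [/\ N%:R <= expR (D * x_ k), forall j, {within cube d, continuous (c j)} &
    forall f, unit_ball F sn f -> exists j, forall x, cube d x ->
      `|f x - c j x| <= delta k].
  have [M [c' [h1 h2 h3]]] := entropy_cover F sn D beta entF _ (delta_gt0 k).
  by exists M, c'.
pose N k := sval (cid (Hex k)).
pose c k : 'I_(N k) -> 'rV[R]_d -> R := sval (cid (svalP (cid (Hex k)))).
have Hc k : [/\ (N k)%:R <= expR (D * x_ k),
    forall j, {within cube d, continuous (c k j)} &
    forall f, unit_ball F sn f -> exists j, forall x, cube d x ->
      `|f x - c k j x| <= delta k].
  exact: svalP (cid (svalP (cid (Hex k)))).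
move: N c Hc => N c Hc {Hex}.
(* Left summands are centres, at which a chain may start at any scale; right summands are
   differences of consecutive centres, the links of a chain. *)
pose I k : finType := ('I_(N k) + 'I_(N k.+1) * 'I_(N k))%type.
pose u k (i : I k) : 'rV[R]_d -> R :=
  match i with inl j => c k j | inr (i, j) => fun x => c k.+1 i x - c k j x end.
have uc k (i : I k) : {within cube d, continuous (u k i)}.
  have cc k' j : {within cube d, continuous (c k' j)} by have [_ + _] := Hc k'.
  case: i => [j|[i j]] /=; first exact: cc.
  by move=> x; apply: cvgB; exact: cc.
have cardI k : #|I k| = (N k + N k.+1 * N k)%N.
  by rewrite card_sum card_prod !card_ord.
pose phi k (i : I k) := noise_stat P sigma b X eps n (lam k / Num.sqrt n%:R) (u k i).
have mphi k i : measurable_fun setT (phi k i).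
  exact: (measurable_noise_stat _ _ _ _ _ _ _ _ model).
have phi0 k i w : 0 <= phi k i w by exact: expR_ge0.
have [W [mW W0 WP Wphi]] := mixture_exists P I phi mphi phi0.
have mdesign : measurable_fun setT (design X n).
  apply: (measurable_tuple_of n (fun i : 'I_n => X i)) => i.
  exact: measurable_funPT.
exists W; split => //.
  move=> B mB; apply: WP => [|k i].
    by rewrite -[X in measurable X]setTI; exact: mdesign.
  exact: (noise_stat_given_design _ f0 _ _ _ _ _ _ model bE f0c).
move=> w f h [Ff fmin].
have snf := seminorm_ge0 Fsn Ff; have snf0 := seminorm_ge0 Fsn Ff0.
have [Woo|Wfin] := eqVneq (W w) +oo%E.
  rewrite Woo addey// mulry gtr0_sg ?mul1e ?leey//.
  by rewrite mulr_gt0 ?powR_gt0// ltr_wpDl.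
have {}Wfin : W w \is a fin_num by rewrite ge0_fin_numE// ltey.
have [v v0 WE] : exists2 v, 0 <= v & W w = v%:E.
  by exists (fine (W w)); rewrite ?fine_ge0// fineK.
rewrite WE -EFinD -EFinM lee_fin.
pose e (i : 'I_n) := sigma * eps i w.
pose g x := f x - f0 x.
pose gX (i : 'I_n) := g (X i w).
have Xc i : cube d (X i w) := model_cube model i w.
pose J := sn f + sn f0 + 1.
have J1 : 0 < J by rewrite ltr_wpDl// addr_ge0.
have Fg : F g.
  have := fspaceD Fsn Ff (fspaceZ Fsn (-1) Ff0).
  by rewrite (_ : _ \+ _ = g)//; apply/funext => x /=; rewrite mulN1r.
have sng : sn g <= sn f + sn f0.
  have := seminormD Fsn Ff (fspaceZ Fsn (-1) Ff0).
  rewrite (seminormZ Fsn)// normrN normr1 mul1r.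
  by rewrite (_ : _ \+ _ = g)//; apply/funext => x /=; rewrite mulN1r.
(* Chaining is done in the unit ball. The summand 1 in J keeps the division legitimate when both
   seminorms vanish. *)
pose g' x := J^-1 * g x.
have Bg' : unit_ball F sn g'.
  split; first exact: (fspaceZ Fsn).
  rewrite (seminormZ Fsn)// ger0_norm ?invr_ge0 ?(ltW J1)//.
  rewrite ler_pdivrMl// mulr1; apply: le_trans sng _.
  by rewrite lerDl.
have Hex k : exists j : 'I_(N k), forall x, cube d x -> `|g' x - c k j x| <= delta k.
  by have [_ _ /(_ _ Bg')] := Hc k.
pose j k := sval (cid (Hex k)).
have Hj k : forall x, cube d x -> `|g' x - c k (j k) x| <= delta k.
  exact: svalP (cid (Hex k)).
pose pi_ k (i : 'I_n) := c k (j k) (X i w).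
have Z0 : 0 <= z0 + z1 * ln (1 + v).
  by rewrite addr_ge0// mulr_ge0 ?(ltW z1_gt0)// ln_ge0// lerDl.
have nle k (i : I k) (ui : 'I_n -> R) : (forall i', ui i' = u k i (X i' w)) ->
    emp_sq n ui <= 4 * delta k ^+ 2 ->
    emp_noise n e ui <= (z0 + z1 * ln (1 + v)) * delta k `^ gam.
  move=> uiE; have {uiE}-> : ui = (fun i' => u k i (X i' w)) by exact/funext.
  apply: (noise_le _ _ _ _ (2 ^+ k.+1 * #|I k|%:R)) => //.
    rewrite cardI; apply: family_weight.
      by have [] := Hc k.
    by have [] := Hc k.+1.
  by have := Wphi k i w; rewrite WE -EFinM lee_fin.
have chain := chaining_bound n e K gam _ n0 K0 gam0 Z0 (fun i => g' (X i w)) pi_.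
have {}chain : emp_noise n e (fun i => g' (X i w)) <= chaining_cst gam *
    (z0 + z1 * ln (1 + v)) * Num.sqrt (emp_sq n (fun i => g' (X i w))) `^ gam.
  apply: chain.
  - by move=> k i; exact: Hj.
  - by move=> k; exact: (nle k (inl (j k))).
  - by move=> k; exact: (nle k (inr (j k.+1, j k))).
  - by move=> i; exact: (unit_ball_bounded F sn Fsn D beta).
set r := Num.sqrt (emp_sq n gX).
have r0 : 0 <= r by exact: sqrtr_ge0.
have rE : emp_sq n gX = r ^+ 2 by rewrite sqr_sqrtr// emp_sq_ge0.
have sqE : emp_sq n (fun i => g' (X i w)) = (J^-1 * r) ^+ 2.
  by rewrite exprMn -rE -emp_sqZ.
have noiseE : emp_noise n e gX = J * emp_noise n e (fun i => g' (X i w)).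
  rewrite -emp_noiseZ; congr emp_noise; apply/funext => i.
  by rewrite /g' mulVKf// gt_eqF.
(* Homogeneity: J (r / J)^gam = J^(beta/2) r^gam, since 1 - gam = beta/2. *)
have noise_g : emp_noise n e gX <=
    chaining_cst gam * (z0 + z1 * ln (1 + v)) * J `^ (beta / 2) * r `^ gam.
  rewrite noiseE -(ler_pM2l (_ : 0 < J^-1)) ?invr_gt0// mulKf ?gt_eqF//.
  apply: le_trans chain _; rewrite sqE sqrtr_sqr ger0_norm; last first.
    by rewrite mulr_ge0// invr_ge0 ltW.
  rewrite powRM ?invr_ge0 ?(ltW J1)// le_eqVlt; apply/orP; left; apply/eqP.
  have -> : J^-1 `^ gam = J^-1 * J `^ (beta / 2).
    rewrite -[J^-1 in LHS]powR_inv1 ?(ltW J1)// -powRrM -[J^-1]powR_inv1 ?(ltW J1)//.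
    rewrite -powRD ?(gt_eqF J1) ?implybT//; congr (_ `^ _); rewrite /gam; by field.
  by ring.
have basic : r ^+ 2 + h ^+ 2 * sn f `^ alpha <=
    2 * (Num.sqrt n%:R)^-1 * emp_noise n e gX + h ^+ 2 * sn f0 `^ alpha.
  have := fmin _ Ff0; rewrite /penalized_risk.
  have dY i : (tnth (sample X Y n w) i).2 - f0 (tnth (sample X Y n w) i).1 = e i.
    by rewrite tnth_mktuple/= (model_Y model) addrAC subrr add0r.
  have dYf i : (tnth (sample X Y n w) i).2 - f (tnth (sample X Y n w) i).1 =
      e i - gX i.
    by rewrite tnth_mktuple/= (model_Y model) /gX /g /e; ring.
  rewrite (eq_bigr (fun i => (e i - gX i) ^+ 2)); last by move=> i _; rewrite dYf.
  rewrite [X in _ <= _ * X + _](eq_bigr (fun i => e i ^+ 2)); last first.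
    by move=> i _; rewrite dY.
  have -> : \sum_(i < n) (e i - gX i) ^+ 2 = \sum_(i < n) e i ^+ 2 -
      2 * \sum_(i < n) e i * gX i + \sum_(i < n) gX i ^+ 2.
    rewrite mulr_sumr -sumrB -big_split/=; apply: eq_bigr => i _; by ring.
  rewrite -rE /emp_sq /emp_noise.
  have sn2 : (Num.sqrt n%:R)^-1 * (Num.sqrt n%:R)^-1 = n%:R^-1 :> R.
    by rewrite -invfM -expr2 sqr_sqrtr// ltW.
  rewrite [2 * _ * (_ * _)](_ : _ = 2 * (n%:R^-1 * \sum_(i < n) e i * gX i)); last first.
    by rewrite -sn2; ring.
  rewrite mulrDr mulrBr.
  rewrite (_ : n%:R^-1 * (2 * \sum_(i < n) e i * gX i) =
    2 * (n%:R^-1 * \sum_(i < n) e i * gX i)); last by ring.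
  by move=> *; lra.
have -> : empirical_norm2 (design X n w) g = r ^+ 2.
  rewrite -rE /empirical_norm2 /emp_sq; congr (_ * _).
  by apply: eq_bigr => i _; rewrite tnth_mktuple.
apply: le_trans (HC n r (sn f) (sn f0) v n0 r0 snf snf0 v0 _) _.
  apply: le_trans basic _; rewrite lerD2r; apply: ler_wpM2l noise_g.
  by rewrite mulr_ge0// invr_ge0 sqrtr_ge0.
rewrite ler_wpM2r ?addr_ge0 ?powR_ge0//.
by rewrite ler_wpM2r ?powR_ge0// lerDl.
Qed.

End oracle_inequality.

(** * From the empirical to the population norm *)

Section population_norm.
Context {R : realType}.

(** The source of the factor 1/2 in the exponent of [sampling_stat]: exp(-x) <= 1 / (1 + x) <= 1 -
    x/2. *)
Lemma expRN_le_half (x : R) : 0 <= x <= 1 -> expR (- x) <= 1 - x / 2.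
Proof.
move=> /andP[x0 x1]; rewrite expRN.
have x10 : 0 < 1 + x by rewrite ltr_wpDr.
apply: (@le_trans _ _ (1 + x)^-1); first by rewrite lef_pV2 ?posrE ?expR_gt0 ?expR_ge1Dx.
rewrite -div1r ler_pdivrMr//.
have -> : (1 - x / 2) * (1 + x) = 1 + x * (1 - x) / 2 by field.
by rewrite lerDl divr_ge0// mulr_ge0// subr_ge0.
Qed.

Lemma clip_close (Q v t : R) : 0 < Q -> `|v| <= Q ->
  `|v - Num.max (- Q) (Num.min Q t)| <= `|v - t|.
Proof.
move=> Q0; rewrite ler_norml => /andP[v1 v2].
rewrite /Num.max /Num.min; case: (ltP Q t) => h2; case: ltP => h1 //.
- by rewrite !ler0_norm; lra.
- by lra.
- by rewrite !ger0_norm; lra.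
Qed.

Context {dO dT : measure_display} {Omega : measurableType dO} {T : measurableType dT}.
Variable P : probability Omega R.

Local Open Scope ereal_scope.

Lemma integral_cstT (c : R) : \int[P]_w (cst c%:E w) = c%:E.
Proof.
transitivity (c%:E * P setT); first exact: integral_cst.
by rewrite probability_setT mule1.
Qed.

Lemma integral_bounded (U : Omega -> R) (M : R) : measurable_fun setT U ->
  (forall w, 0 <= U w <= M)%R ->
  exists2 m, (0 <= m <= M)%R & \int[P]_w (U w)%:E = m%:E.
Proof.
move=> mU UM.
have U0 : 0 <= \int[P]_w (U w)%:E.
  by apply: integral_ge0 => w _; rewrite lee_fin; have /andP[] := UM w.
have UleM : \int[P]_w (U w)%:E <= M%:E.
  rewrite -[leRHS]integral_cstT.
  apply: ge0_le_integral => //.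
  - by move=> w _; rewrite lee_fin; have /andP[] := UM w.
  - exact/measurable_EFinP.
  - by move=> w _; rewrite lee_fin; have /andP[] := UM w.
have Ufin : \int[P]_w (U w)%:E \is a fin_num.
  by rewrite ge0_fin_numE// (le_lt_trans UleM)// ltry.
exists (fine (\int[P]_w (U w)%:E)); last by rewrite fineK.
by rewrite fine_ge0//= -lee_fin fineK.
Qed.

Lemma integral_expRN_le (U : Omega -> R) (M m : R) : (0 < M)%R ->
  measurable_fun setT U -> (forall w, 0 <= U w <= M)%R ->
  \int[P]_w (U w)%:E = m%:E ->
  \int[P]_w (expR (- (U w / M)))%:E <= (expR (- (m / M / 2)))%:E.
Proof.
move=> M0 mU UM mE.
have mexp : measurable_fun setT (fun w => (expR (- (U w / M)))%:E).
  apply/measurable_EFinP.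
  apply: (measurableT_comp (continuous_measurable_fun (@continuous_expR R))).
  by apply: measurable_funN; apply: measurable_funM.
have mU2 : measurable_fun setT (fun w => ((M * 2)^-1)%:E * (U w)%:E).
  by apply: emeasurable_funM => //; exact/measurable_EFinP.
have c0 : (0 <= (M * 2)^-1)%R by rewrite invr_ge0 mulr_ge0// ltW.
have UE : \int[P]_w (((M * 2)^-1)%:E * (U w)%:E) = (m / M / 2)%:E.
  rewrite ge0_integralZl//; last 2 first.
  - exact/measurable_EFinP.
  - by move=> w _; rewrite lee_fin; have /andP[] := UM w.
  by rewrite mE -EFinM invfM; congr EFin; ring.
(* The inequality is integrated as exp(-x) + x/2 <= 1, which keeps every integrand nonnegative. *)
have sumle : \int[P]_w ((expR (- (U w / M)))%:E + ((M * 2)^-1)%:E * (U w)%:E) <= 1.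
  rewrite -[leRHS]integral_cstT.
  apply: ge0_le_integral => //.
  - move=> w _; rewrite adde_ge0 ?mule_ge0 ?lee_fin ?expR_ge0//.
    by have /andP[] := UM w.
  - exact: emeasurable_funD.
  - move=> w _; rewrite -EFinM -EFinD lee_fin.
    have /andP[U0 U1] := UM w.
    have := @expRN_le_half (U w / M); rewrite divr_ge0 ?(ltW M0)//= ler_pdivrMr// mul1r.
    have -> : ((M * 2)^-1 * U w = U w / M / 2)%R by rewrite invfM; ring.
    by move=> /(_ U1); rewrite lerBrDr.
have exp0 w : [set: Omega] w -> 0 <= (expR (- (U w / M)))%:E.
  by move=> _; rewrite lee_fin expR_ge0.
have U0 w : [set: Omega] w -> 0 <= ((M * 2)^-1)%:E * (U w)%:E.
  by move=> _; rewrite mule_ge0// lee_fin//; have /andP[] := UM w.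
move: sumle; rewrite (ge0_integralD P measurableT exp0 mexp U0 mU2) UE => sumle.
have : \int[P]_w (expR (- (U w / M)))%:E <= (1 - m / M / 2)%:E.
  by rewrite EFinB leeBrDr.
move=> /le_trans; apply; rewrite lee_fin.
exact: expR_ge1Dx.
Qed.

Lemma identically_distributed_integral (V1 V2 : Omega -> T) (phi : T -> \bar R) :
  measurable_fun setT V1 -> measurable_fun setT V2 ->
  (forall A, measurable A -> P (V1 @^-1` A) = P (V2 @^-1` A)) ->
  measurable_fun setT phi -> (forall v, 0 <= phi v) ->
  \int[P]_w phi (V1 w) = \int[P]_w phi (V2 w).
Proof.
move=> mV1 mV2 V12 mphi phi0.
have E (V : Omega -> T) : measurable_fun setT V ->
    \int[P]_w phi (V w) = \int[pushforward P V]_v phi v.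
  by move=> mV; rewrite ge0_integral_pushforward.
rewrite !E//; apply: eq_measure_integral => A mA _; exact: V12.
Qed.

End population_norm.

Section sampling.
Context {R : realType} {d : nat} {dO : measure_display}.
Context {Omega : measurableType dO} (P : probability Omega R).
Variables (f0 : 'rV[R]_d -> R) (sigma b_eps : R).
Variables (X : nat -> {RV P >-> 'rV[R]_d}) (Y eps : nat -> {RV P >-> R}).
Hypothesis model : regression_model f0 sigma b_eps X Y eps.

Let mX i : measurable_fun setT (X i).
Proof. exact: measurable_funPT. Qed.

Let Xc i w : cube d (X i w). Proof. exact: (model_cube model). Qed.

Local Open Scope ereal_scope.

Lemma L2_norm2E (g : 'rV[R]_d -> R) : measurable_fun (cube d) g ->
  L2_norm2 (distribution P (X 0%N)) g = \int[P]_w ((g (X 0%N w)) ^+ 2)%:E.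
Proof.
move=> mg; rewrite /L2_norm2 /distribution ge0_integral_pushforward//.
- by rewrite (_ : _ @^-1` _ = setT)//; apply/seteqP; split => // w _; exact: Xc.
- exact: measurable_cube.
- by apply/measurable_EFinP; exact: measurable_funX.
- by move=> x _; rewrite lee_fin sqr_ge0.
Qed.

Definition sampling_stat (n : nat) (Q m : R) (u : 'rV[R]_d -> R) (w : Omega) : R :=
  expR (n%:R * (m / Q ^+ 2 / 2) - (\sum_(i < n) u (X i w) ^+ 2) / Q ^+ 2).

Lemma measurable_sampling_stat n (Q m : R) (u : 'rV[R]_d -> R) : measurable_fun setT u ->
  measurable_fun setT (sampling_stat n Q m u).
Proof.
move=> mu.
apply: (measurableT_comp (continuous_measurable_fun (@continuous_expR R))).
apply: measurable_funB => //; apply: measurable_funM => //.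
apply: measurable_sum => i; apply: measurable_funX.
exact: (measurableT_comp mu (mX i)).
Qed.

Lemma integral_sampling_stat n (Q m : R) (u : 'rV[R]_d -> R) : (0 < Q)%R -> measurable_fun setT u ->
  (forall x, `|u x| <= Q)%R -> \int[P]_w (u (X 0%N w) ^+ 2)%:E = m%:E ->
  \int[P]_w (sampling_stat n Q m u w)%:E <= 1.
Proof.
move=> Q0 mu uQ mE.
have Q20 : (0 < Q ^+ 2)%R by rewrite exprn_gt0.
have uX i : measurable_fun setT (fun w => u (X i w) ^+ 2)%R.
  by apply: measurable_funX; exact: (measurableT_comp mu (mX i)).
have uX2 i w : (0 <= u (X i w) ^+ 2 <= Q ^+ 2)%R.
  by rewrite sqr_ge0/= sqr_norm_le.
(* Written on pairs, although it ignores y, because the model is i.i.d. in the pairs. *)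
pose psi (z : 'rV[R]_d * R) := expR (- (u z.1 ^+ 2 / Q ^+ 2)).
have mpsi : measurable_fun setT psi.
  apply: (measurableT_comp (continuous_measurable_fun (@continuous_expR R))).
  apply: measurable_funN; apply: measurable_funM => //; apply: measurable_funX.
  exact: (measurableT_comp mu).
have mZ i : measurable_fun setT (fun w => (X i w, Y i w)).
  by apply/measurable_fun_pairP; split; exact: measurable_funPT.
have psi0 z : (0 <= psi z)%R by exact: expR_ge0.
have psiE i : \int[P]_w (psi (X i w, Y i w))%:E <= (expR (- (m / Q ^+ 2 / 2)))%:E.
  rewrite (identically_distributed_integral P (fun w => (X i w, Y i w))
    (fun w => (X 0%N w, Y 0%N w)) (EFin \o psi))//.
  - exact: (integral_expRN_le P (fun w => u (X 0%N w) ^+ 2)%R).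
  - by move=> A mA; exact: (model_ident model).
  - exact/measurable_EFinP.
have indep (A : 'I_n -> set ('rV[R]_d * R)) : (forall i, measurable (A i)) ->
    P [set w | forall i : 'I_n, A i (X i w, Y i w)] =
    \prod_(i < n) P ((fun w => (X i w, Y i w)) @^-1` A i).
  exact: (independent_family_prefix _ _ _ (model_indep model)).
have prodE := independent_integral_prod P n (fun i w => (X i w, Y i w))
  (fun i => mZ i) indep (fun=> psi) (fun=> mpsi) (fun=> psi0)
  (fun i => le_lt_trans (psiE i) (ltry _)).
have statE w : sampling_stat n Q m u w =
    (expR (n%:R * (m / Q ^+ 2 / 2)) * \prod_(i < n) psi (X i w, Y i w))%R.
  by rewrite /sampling_stat expRD mulr_suml -sumrN expR_sum.
under eq_integral do rewrite statE EFinM.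
rewrite ge0_integralZl ?lee_fin ?expR_ge0//; last 2 first.
- apply/measurable_EFinP; apply: measurable_prodr => i.
  exact: (measurableT_comp mpsi (mZ i)).
- by move=> w _; rewrite lee_fin; exact: prodr_ge0.
rewrite prodE.
have pfin (i : 'I_n) : \int[P]_w (psi (X i w, Y i w))%:E \is a fin_num.
  rewrite ge0_fin_numE; first exact: le_lt_trans (psiE i) (ltry _).
  by apply: integral_ge0 => w _; rewrite lee_fin.
rewrite (eq_bigr (fun i : 'I_n => (fine (\int[P]_w (psi (X i w, Y i w))%:E))%:E)); last first.
  by move=> i _; rewrite fineK.
rewrite prodEFin -EFinM lee_fin.
apply: (@le_trans _ _ (expR (n%:R * (m / Q ^+ 2 / 2)) *
    \prod_(i < n) expR (- (m / Q ^+ 2 / 2)))%R).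
  apply: ler_wpM2l; first exact: expR_ge0.
  apply: ler_prod => i _; rewrite -lee_fin fineK// psiE andbT -lee_fin fineK//.
  by apply: integral_ge0 => w _; rewrite lee_fin.
rewrite prodr_const card_ord -expRM_natl -expRD.
by rewrite mulrN subrr expR0.
Qed.

End sampling.

(** * Resolution at each dyadic seminorm radius *)

Section population_scales.
Context {R : realType}.
Variables (beta : R).
Hypotheses (beta_gt0 : 0 < beta) (beta_lt2 : beta < 2).

Let kap := 2 * beta / (beta + 2).

Let b2 : 0 < beta + 2. Proof. by rewrite addr_gt0. Qed.

Let b2' : 2 + beta != 0. Proof. by rewrite addrC gt_eqF. Qed.

Let b2n : beta + 2 != 0. Proof. by rewrite gt_eqF. Qed.

Definition pop_scale (x nu : R) : R :=
  x `^ (beta / (2 + beta)) * nu `^ (- 1 / (2 + beta)).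

Lemma pop_scale_gt0 x nu : 0 < x -> 0 < nu -> 0 < pop_scale x nu.
Proof. by move=> x0 nu0; rewrite mulr_gt0 ?powR_gt0. Qed.

Lemma pop_scale_sqr x nu :
  pop_scale x nu ^+ 2 = x `^ kap * nu `^ (- 2 / (2 + beta)).
Proof.
rewrite exprMn -!powR_mulrn ?powR_ge0// -!powRrM.
have -> : beta / (2 + beta) * 2%:R = kap by rewrite /kap [2 + beta]addrC; field.
by have -> : - 1 / (2 + beta) * 2%:R = - 2 / (2 + beta) by field.
Qed.

(* The radius is chosen so that the entropy of the unit ball at this radius
   matches the exponent [nu * pop_scale x nu ^+ 2] of the deviation bound. *)
Lemma pop_radius_powR x nu : 0 < x -> 0 < nu ->
  (pop_scale x nu / x) `^ (- beta) = nu * pop_scale x nu ^+ 2.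
Proof.
move=> x0 nu0; rewrite pop_scale_sqr.
have -> : pop_scale x nu / x = x `^ (beta / (2 + beta) - 1) * nu `^ (- 1 / (2 + beta)).
  by rewrite /pop_scale powRD ?(gt_eqF x0) ?implybT// powR_inv1 ?(ltW x0)// mulrAC.
rewrite powRM ?powR_ge0// -!powRrM mulrCA.
have xkap : (beta / (2 + beta) - 1) * - beta = kap by rewrite /kap [2 + beta]addrC; field.
have nukap : - 1 / (2 + beta) * - beta = 1 + - 2 / (2 + beta) by field.
rewrite xkap nukap; congr (_ * _).
by rewrite powRD ?(gt_eqF nu0) ?implybT// powRr1 ?(ltW nu0).
Qed.

(** Absorbs the logarithm of the mixture weight 2^(-(j+1)) in the squared resolution at radius
    2^j. *)
Lemma succn_le_powR : exists2 c, 0 < c & forall j : nat,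
  j.+1%:R <= c * (2 ^+ j) `^ kap :> R.
Proof.
have kap0 : 0 < kap by rewrite divr_gt0// mulr_gt0.
have l2 : 0 < ln 2 :> R by rewrite ln_gt0// ltr1n.
have kl : 0 < kap * ln 2 by rewrite mulr_gt0.
exists (1 + (kap * ln 2)^-1) => [|j]; first by rewrite addr_gt0// invr_gt0.
have -> : ((2 : R) ^+ j) `^ kap = expR (j%:R * (kap * ln 2)).
  rewrite /powR expf_eq0 pnatr_eq0 andbF; congr expR.
  by rewrite lnXn// -[ln 2 *+ j]mulr_natl mulrCA.
set E := expR _.
have E1 : 1 + j%:R * (kap * ln 2) <= E by exact: expR_ge1Dx.
have E2 : 1 <= E by rewrite -expR0 ler_expR mulr_ge0// ltW.
have E3 : j%:R <= (kap * ln 2)^-1 * E.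
  rewrite ler_pdivlMl// mulrC; apply: le_trans E1.
  by rewrite lerDr.
by rewrite -natr1 mulrDl mul1r addrC lerD.
Qed.

Lemma dyadic_above (J : R) : 1 <= J -> exists j : nat, J <= 2 ^+ j <= 2 * J.
Proof.
move=> J1; have [k Jk] := lt_pow2 J.
have Hex : exists k, J <= 2 ^+ k by exists k; exact: ltW.
case: (ex_minnP Hex) => -[|m] Hm mmin.
  by exists 0%N; rewrite Hm/= expr0; lra.
exists m.+1; rewrite Hm exprS ler_pM2l//=.
by rewrite leNgt; apply/negP => /ltW /mmin; rewrite ltnn.
Qed.

Lemma dyadic_powR_le (J : R) (j : nat) : 1 <= J -> 2 ^+ j <= 2 * J ->
  (2 ^+ j) `^ kap <= 2 * J `^ kap.
Proof.
move=> J1 jJ; have J0 : 0 <= J by exact: le_trans J1.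
have kap0 : 0 < kap by rewrite divr_gt0// mulr_gt0.
apply: (@le_trans _ _ ((2 * J) `^ kap)).
  by apply: ler_powR_base; rewrite ?(ltW kap0)// exprn_ge0.
have kap1 : kap <= 1 by rewrite /kap ler_pdivrMr// mul1r mulr_natl mulr2n lerD2l ltW.
rewrite powRM// ler_wpM2r ?powR_ge0// -[leRHS]powRr1//.
by apply: ler_powR; rewrite ?ler1n.
Qed.

Lemma invn_le_rate (n : nat) : (0 < n)%N -> n%:R^-1 <= n%:R `^ (- 2 / (2 + beta)) :> R.
Proof.
move=> n0; rewrite -powR_inv1 ?ler0n//; apply: ler_powR; first by rewrite ler1n.
by rewrite mulNr lerN2 ler_pdivrMr [2 + beta]addrC// mul1r lerDr ltW.
Qed.

End population_scales.

Section population.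
Context {R : realType} {d : nat} {dO : measure_display}.
Context {Omega : measurableType dO} (P : probability Omega R).
Variables (f0 : 'rV[R]_d -> R) (sigma b_eps : R).
Variables (X : nat -> {RV P >-> 'rV[R]_d}) (Y eps : nat -> {RV P >-> R}).
Hypothesis model : regression_model f0 sigma b_eps X Y eps.

Lemma le_of_sampling_stat n (Q m L : R) (u : 'rV[R]_d -> R) (w : Omega) :
  (0 < n)%N -> 0 < Q -> sampling_stat P X n Q m u w <= expR L ->
  m <= 2 * emp_sq n (fun i => u (X i w)) + 2 * Q ^+ 2 * (L / n%:R).
Proof.
move=> n0 Q0; rewrite ler_expR lerBlDr /emp_sq; set S := \sum_(i < n) _ => H.
have nR : 0 < n%:R :> R by rewrite ltr0n.
have Q2 : 0 < Q ^+ 2 by rewrite exprn_gt0.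
have c0 : 0 < 2 * Q ^+ 2 / n%:R by rewrite divr_gt0// mulr_gt0.
have := ler_wpM2l (ltW c0) H.
have -> : 2 * Q ^+ 2 / n%:R * (n%:R * (m / Q ^+ 2 / 2)) = m.
  by field; rewrite !gt_eqF.
move/le_trans; apply; rewrite le_eqVlt; apply/orP; left; apply/eqP.
by field; rewrite !gt_eqF.
Qed.

Lemma L2_norm2_le_close (g u : 'rV[R]_d -> R) (m s : R) :
  {within cube d, continuous g} -> measurable_fun setT u ->
  (forall x, cube d x -> `|g x - u x| <= s) ->
  (\int[P]_w (u (X 0%N w) ^+ 2)%:E = m%:E)%E ->
  (L2_norm2 (distribution P (X 0%N)) g <= (2 * m + 2 * s ^+ 2)%:E)%E.
Proof.
move=> cg mu gu mE.
have Xc i w : cube d (X i w) by exact: (model_cube model).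
have muX : measurable_fun setT (fun w => u (X 0%N w) ^+ 2).
  by apply: measurable_funX; apply: (measurableT_comp mu); exact: measurable_funPT.
rewrite (L2_norm2E _ _ _ _ _ _ _ model); last first.
  by apply: measurable_within_continuous => //; exact: measurable_cube.
have -> : ((2 * m + 2 * s ^+ 2)%:E =
    \int[P]_w (2%:E * (u (X 0%N w) ^+ 2)%:E + cst (2 * s ^+ 2)%:E w))%E.
  have h1 w : setT w -> (0 <= 2%:E * (u (X 0%N w) ^+ 2)%:E)%E.
    by move=> _; rewrite -EFinM lee_fin mulr_ge0// sqr_ge0.
  have h2 (w : Omega) : setT w -> (0 <= cst (2 * s ^+ 2)%:E w)%E.
    by move=> _; rewrite lee_fin mulr_ge0// sqr_ge0.
  have m1 : measurable_fun setT (fun w => (2%:E * (u (X 0%N w) ^+ 2)%:E)%E).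
    by apply: emeasurable_funM => //; exact/measurable_EFinP.
  rewrite (ge0_integralD P measurableT h1 m1 h2 (measurable_cst _)).
  rewrite ge0_integralZl//; last 2 first.
  - exact/measurable_EFinP.
  - by move=> w _; rewrite lee_fin sqr_ge0.
  by rewrite mE integral_cstT -EFinM -EFinD.
apply: ge0_le_integral => //.
- by move=> w _; rewrite lee_fin sqr_ge0.
- apply/measurable_EFinP; apply: measurable_funX.
  exact: (measurable_cube_comp P _ _ _ _ _ _ model).
- apply: emeasurable_funD => //; apply: emeasurable_funM => //.
  exact/measurable_EFinP.
- move=> w _; rewrite -EFinM -EFinD lee_fin /=.
  by apply: sqr_le_close; rewrite distrC; exact: gu.
Qed.

End population.

(** W is fixed before g and J, so the bound applies to a sample-dependent g and to a J computed from
    its random seminorm. *)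
Lemma population_le_empirical (R : realType) (beta D Q : R) :
  0 < beta -> beta < 2 -> 0 < D -> 0 < Q ->
  exists c1 c2 : R, [/\ 0 < c1, 0 < c2 & forall (d : nat)
    (F : set ('rV[R]_d -> R)) (sn : ('rV[R]_d -> R) -> R),
  seminormed_function_space F sn ->
  (forall delta : R, 0 < delta ->
    (sup_entropy delta (unit_ball F sn) <= (D * delta `^ (- beta))%:E)%E) ->
  forall (dO : measure_display) (Omega : measurableType dO)
    (P : probability Omega R) (f0 : 'rV[R]_d -> R) (sigma b_eps : R)
    (X : nat -> {RV P >-> 'rV[R]_d}) (Y eps : nat -> {RV P >-> R}),
  regression_model f0 sigma b_eps X Y eps ->
  forall n : nat, (0 < n)%N ->
  exists W : Omega -> \bar R, [/\ measurable_fun setT W,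
    (forall w, (0 <= W w)%E), (\int[P]_w W w <= 1)%E &
    forall w g J, F g -> 1 <= J -> sn g <= J ->
      (forall x, cube d x -> `|g x| <= Q) ->
      (L2_norm2 (distribution P (X 0%N)) g <=
       (8 * empirical_norm2 (design X n w) g +
        c1 * J `^ (2 * beta / (beta + 2)) * n%:R `^ (- 2 / (2 + beta)))%:E +
       (c2 * n%:R `^ (- 2 / (2 + beta)))%:E * W w)%E]].
Proof.
move=> beta0 beta2 D0 Q0.
have [c c0 cP] := succn_le_powR beta beta0.
have Q2 : 0 < Q ^+ 2 by rewrite exprn_gt0.
have C0 : 0 < 10 + 4 * Q ^+ 2 * (c + D) by rewrite addr_gt0// !mulr_gt0// addr_gt0.
(* With s the resolution, E the empirical norm of g and t the value of W, the three comparisons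
   L2(g) <= 2 m + 2 s^2, m <= 2 S + 2 Q^2 L and S <= 2 E + 2 s^2 give 8 E + 10 s^2 + 4 Q^2 L, where
   L <= (c + D) s^2 + t nu. The outer 2 comes from replacing 2^j by J. *)
exists (2 * (10 + 4 * Q ^+ 2 * (c + D))), (4 * Q ^+ 2); split.
- by rewrite mulr_gt0.
- by rewrite mulr_gt0.
move=> d F sn Fsn entF dO Omega P f0 sigma b_eps X Y eps model n n0.
have nR : 0 < n%:R :> R by rewrite ltr0n.
have p2 j : 0 < (2 : R) ^+ j by rewrite exprn_gt0.
pose del j := pop_scale beta ((2 : R) ^+ j) n%:R.
have del0 j : 0 < del j by exact: pop_scale_gt0.
have r0 j : 0 < del j / 2 ^+ j by rewrite divr_gt0.
have entr j : (del j / 2 ^+ j) `^ (- beta) = n%:R * del j ^+ 2.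
  by rewrite pop_radius_powR.
have /choice[kc kcP] : forall j : nat,
    exists kc : {k : nat & 'I_k -> 'rV[R]_d -> R},
    [/\ (projT1 kc)%:R <= expR (D * (n%:R * del j ^+ 2)),
      (forall i, {within cube d, continuous (projT2 kc i)}) &
      forall f, unit_ball F sn f -> exists i, forall x, cube d x ->
        `|f x - projT2 kc i x| <= del j / 2 ^+ j].
  move=> j; have [k [ck [H1 H2 H3]]] := entropy_cover F sn D beta entF _ (r0 j).
  by rewrite entr in H1; exists (existT _ k ck).
(* Centres are scaled back to radius 2^j. Clipping supplies the bound Q needed for the exponential
   moment, without moving them away from functions bounded by Q. *)
pose u j i (x : 'rV[R]_d) : R :=
  Num.max (- Q) (Num.min Q (2 ^+ j * (projT2 (kc j) i \_ (cube d)) x)).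
have mu j i : measurable_fun setT (u j i).
  have [_ /(_ i) cj _] := kcP j.
  apply: measurable_maxr => //; apply: measurable_minr => //.
  apply: measurable_funM => //.
  apply: (measurable_restrictT _ measurable_cube).1.
  by apply: measurable_within_continuous => //; exact: measurable_cube.
have uQ j i x : `|u j i x| <= Q.
  rewrite /u ler_norml /Num.max /Num.min.
  by case: (ltP Q) => H1; case: ltP => H2; apply/andP; split; lra.
pose m j i := fine (\int[P]_w (u j i (X 0%N w) ^+ 2)%:E)%E.
have mE j i : (\int[P]_w (u j i (X 0%N w) ^+ 2)%:E = (m j i)%:E)%E.
  have [|w|m' _ E] := integral_bounded P (fun w => u j i (X 0%N w) ^+ 2) (Q ^+ 2).
  - by apply: measurable_funX; apply: (measurableT_comp (mu j i)); exact: measurable_funPT.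
  - by rewrite sqr_ge0/= sqr_norm_le.
  - by rewrite /m E.
pose phi j (i : 'I_(projT1 (kc j))) := sampling_stat P X n Q (m j i) (u j i).
have mphi j i : measurable_fun setT (phi j i) by exact: measurable_sampling_stat.
have phi0 j i w : 0 <= phi j i w by exact: expR_ge0.
have [W [mW W0 WP Wphi]] :=
  mixture_exists P (fun j => 'I_(projT1 (kc j)))%type phi mphi phi0.
exists W; split => //.
  rewrite -(probability_setT P); apply: WP => // j i; rewrite probability_setT.
  exact: (integral_sampling_stat P _ _ _ _ _ _ model).
move=> w g J Fg J1 gJ gQ.
set nu := n%:R `^ (- 2 / (2 + beta)).
have nu0 : 0 < nu by rewrite powR_gt0.
have [j /andP[Jj jJ]] := dyadic_above J J1.
have [Nj _ cov] := kcP j.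
have [i gi] : exists i, forall x, cube d x ->
    `|(2 ^+ j)^-1 * g x - projT2 (kc j) i x| <= del j / 2 ^+ j.
  apply: (cov (fun x => (2 ^+ j)^-1 * g x)); split.
    exact: (fspaceZ Fsn).
  rewrite (seminormZ Fsn)// gtr0_norm ?invr_gt0// ler_pdivrMl// mulr1.
  exact: le_trans gJ Jj.
have gu x : cube d x -> `|g x - u j i x| <= del j.
  move=> cx; apply: le_trans (clip_close _ _ _ Q0 (gQ _ cx)) _.
  rewrite patchT ?inE//.
  have -> : g x - 2 ^+ j * projT2 (kc j) i x =
      2 ^+ j * ((2 ^+ j)^-1 * g x - projT2 (kc j) i x).
    by rewrite mulrBr mulVKf// gt_eqF.
  by rewrite normrM gtr0_norm// mulrC -ler_pdivlMr// gi.
have cg : {within cube d, continuous g} by exact: (fspace_continuous Fsn).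
apply: (le_trans (L2_norm2_le_close P _ _ _ _ _ _ model _ _ _ _ cg (mu j i) gu (mE j i))).
move: (Wphi j i w) (W0 w); case: (W w) => [t| |//]; last first.
  by move=> _ _; rewrite gt0_muley ?lte_fin ?mulr_gt0// addey// leey.
rewrite -!EFinM -EFinD !lee_fin card_ord => Wt t0.
(* The three factors are at most exponentials: 2^(j+1) of the weight, the cardinality of the cover,
   and W itself through t <= exp(t). *)
have Wexp : phi j i w <= expR (j.+1%:R + D * (n%:R * del j ^+ 2) + t).
  apply: (le_trans Wt); rewrite !expRD; apply: ler_pM => //.
  - apply: ler_pM => //.
    rewrite -[j.+1%:R]mulr1 expRM_natl; apply: lerXn2r; rewrite ?nnegrE ?expR_ge0//.
    by apply: le_trans (expR_ge1Dx 1); rewrite -natr1.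
  - by apply: le_trans (expR_ge1Dx t); rewrite lerDr.
have := le_of_sampling_stat _ _ _ _ _ _ _ _ n0 Q0 Wexp.
set Sq := emp_sq _ _ => mle.
have Sle : Sq <= 2 * empirical_norm2 (design X n w) g + 2 * del j ^+ 2.
  rewrite /Sq /emp_sq /empirical_norm2.
  have -> : 2 * (n%:R^-1 * \sum_(i0 < n) g (tnth (design X n w) i0) ^+ 2) + 2 * del j ^+ 2 =
      n%:R^-1 * \sum_(i0 < n) (2 * g (tnth (design X n w) i0) ^+ 2 + 2 * del j ^+ 2).
    rewrite big_split/= -mulr_sumr sumr_const card_ord -[_ *+ n]mulr_natl.
    by field; rewrite gt_eqF.
  rewrite ler_wpM2l ?invr_ge0 ?ler0n//; apply: ler_sum => i0 _.
  rewrite tnth_mktuple; apply: sqr_le_close; apply: gu.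
  exact: (model_cube model).
have s0 : 0 <= del j ^+ 2 by exact: sqr_ge0.
have sE : del j ^+ 2 = (2 ^+ j) `^ (2 * beta / (beta + 2)) * nu.
  exact: pop_scale_sqr.
have invn : n%:R^-1 <= nu by exact: invn_le_rate.
have Lle : (j.+1%:R + D * (n%:R * del j ^+ 2) + t) / n%:R <=
    (c + D) * del j ^+ 2 + t * nu.
  have -> : (j.+1%:R + D * (n%:R * del j ^+ 2) + t) / n%:R =
      j.+1%:R / n%:R + D * del j ^+ 2 + t / n%:R by field; rewrite gt_eqF.
  rewrite mulrDl !lerD// ?ler_wpM2l//.
  rewrite sE mulrA; apply: ler_pM => //; rewrite ?invr_ge0 ?ler0n//.
have sle : del j ^+ 2 <= 2 * J `^ (2 * beta / (beta + 2)) * nu.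
  by rewrite sE ler_wpM2r ?(ltW nu0)//; exact: dyadic_powR_le.
have Q2L := ler_wpM2l (ltW Q2) Lle.
have Csle := ler_wpM2l (ltW C0) sle.
rewrite -/(empirical_norm2 (design X n w) g).
move: mle Sle Q2L Csle; set L := _ / n%:R; set E := empirical_norm2 _ _.
set s := del j ^+ 2; set Jk := J `^ _; set q := Q ^+ 2; clearbody L E s Jk q nu.
by move=> mle Sle Q2L Csle; nra.
Qed.

(** * Risk bounds *)

Section integral_upper_bounds.
Context {R : realType} {dO : measure_display} {Omega : measurableType dO}.
Variable P : probability Omega R.

Local Open Scope ereal_scope.

Import HBNNSimple.

(* No measurability of [f] is needed: a simple function below [f] is almost
   everywhere below [g]. *)
Lemma ae_le_integral_nonmeasurable (f g : Omega -> \bar R) :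
  (forall w, 0 <= f w) -> measurable_fun setT g -> (forall w, 0 <= g w) ->
  {ae P, forall w, f w <= g w} -> \int[P]_w f w <= \int[P]_w g w.
Proof.
move=> f0 mg g0 fg; rewrite ge0_integralTE//.
apply: ge_ereal_sup => _ [h hf <-].
rewrite -integralT_nnsfun; apply: ae_ge0_le_integral => //.
- by move=> w _; rewrite lee_fin; exact: fun_ge0.
- by apply/measurable_EFinP.
- by apply: filterS fg => w fgw _; apply: le_trans fgw; exact: hf.
Qed.

Lemma integral_affine_le (W : Omega -> \bar R) (k A : R) (B : set Omega) :
  measurable B -> measurable_fun setT W -> (forall w, 0 <= W w) ->
  (0 <= k)%R -> (0 <= A)%R -> \int[P]_(w in B) W w <= P B ->
  \int[P]_(w in B) (k%:E * (A%:E + W w)) <= (k * (A + 1))%:E * P B.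
Proof.
move=> mB mW W0 k0 A0 WB.
have mWB : measurable_fun B W by exact: measurable_funTS.
rewrite ge0_integralZl//; first last.
- by move=> w _; rewrite adde_ge0 ?lee_fin.
- exact: emeasurable_funD.
have h1 w : B w -> 0 <= cst A%:E w by rewrite /= lee_fin.
rewrite (ge0_integralD P mB h1 (measurable_cst _) (fun w _ => W0 w) mWB).
rewrite integral_cst// EFinM -muleA lee_wpmul2l ?lee_fin//.
by rewrite EFinD ge0_muleDl ?mul1e ?lee_fin// leeD2l.
Qed.

End integral_upper_bounds.

Section estimator.
Context {R : realType} {d : nat} {dO : measure_display}.
Context {Omega : measurableType dO} (P : probability Omega R).
Variables (F : set ('rV[R]_d -> R)) (sn : ('rV[R]_d -> R) -> R).
Hypothesis Fsn : seminormed_function_space F sn.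

Lemma fspaceB f g : F f -> F g -> F (fun x => f x - g x).
Proof.
move=> Ff Fg; have := fspaceD Fsn Ff (fspaceZ Fsn (- 1) Fg).
by congr F; apply/funext => x /=; rewrite mulN1r.
Qed.

Lemma seminormB f g : F f -> F g -> sn (fun x => f x - g x) <= sn f + sn g.
Proof.
move=> Ff Fg; have FNg := fspaceZ Fsn (- 1) Fg.
have -> : sn (fun x => f x - g x) = sn (f \+ (fun x => - 1 * g x)).
  by congr sn; apply/funext => x /=; rewrite mulN1r.
apply: le_trans (seminormD Fsn Ff FNg) _.
by rewrite (seminormZ Fsn)// normrN1 mul1r.
Qed.

Variables (f0 : 'rV[R]_d -> R) (sigma b_eps : R).
Variables (X : nat -> {RV P >-> 'rV[R]_d}) (Y eps : nat -> {RV P >-> R}).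
Hypothesis model : regression_model f0 sigma b_eps X Y eps.
Hypothesis Ff0 : F f0.

Lemma measurable_design n : measurable_fun setT (design X n).
Proof.
apply: (measurable_tuple_of n (fun i : 'I_n => X i)) => i.
exact: measurable_funPT.
Qed.

Lemma measurable_sample n : measurable_fun setT (sample X Y n).
Proof.
apply: (measurable_tuple_of n (fun (i : 'I_n) w => (X i w, Y i w))) => i.
by apply/measurable_fun_pairP; split; exact: measurable_funPT.
Qed.

(** The estimator is measurable in the sample at each fixed point and continuous in the point, so it
    can be evaluated at the random design points. *)
Lemma measurable_empirical_risk n (fbar : n.-tuple ('rV[R]_d * R) -> 'rV[R]_d -> R) :
  measurable_estimator fbar -> (forall w, F (fbar (sample X Y n w))) ->
  measurable_fun setT (fun w => empirical_norm2 (design X n w)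
    (fun x => fbar (sample X Y n w) x - f0 x)).
Proof.
move=> mfbar Ffbar; apply: measurable_funM => //.
apply: measurable_sum => i; apply: measurable_funX.
under eq_fun do rewrite tnth_mktuple.
apply: (measurable_caratheodory (fun w x => fbar (sample X Y n w) x - f0 x)).
- exact: measurable_funPT.
- by move=> w; exact: (model_cube model).
- move=> x cx; apply: measurable_funB => //.
  exact: (measurableT_comp (mfbar x cx) (measurable_sample n)).
- by move=> w; apply: (fspace_continuous Fsn); exact: fspaceB.
Qed.

End estimator.

Theorem theorem2 (R : realType) (a beta alpha b D : R)
    (a_gt0 : 0 < a) (beta_gt0 : 0 < beta) (beta_lt2 : beta < 2)
    (alpha_gt : 2 * beta / (beta + 2) < alpha) (b_gt0 : 0 < b)
    (D_gt0 : 0 < D) :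
  exists (C1 : R) (n1 : nat),
    (forall (d : nat) (F : set ('rV[R]_d -> R)) (sn : ('rV[R]_d -> R) -> R),
      seminormed_function_space F sn ->
      (forall delta : R, 0 < delta ->
        (sup_entropy delta (unit_ball F sn) <= (D * delta `^ (- beta))%:E)%E) ->
      forall (dO : measure_display) (Omega : measurableType dO)
        (P : probability Omega R) (f0 : 'rV[R]_d -> R) (sigma b_eps : R)
        (X : nat -> {RV P >-> 'rV[R]_d}) (Y eps : nat -> {RV P >-> R}),
      regression_model f0 sigma b_eps X Y eps ->
      b = sigma * b_eps ->
      F f0 ->
      forall (n : nat), (n1 <= n)%N ->
      forall (fbar : n.-tuple ('rV[R]_d * R) -> 'rV[R]_d -> R),
      measurable_estimator fbar ->
      (forall w, penalized_erm (a * n%:R `^ (- 1 / (2 + beta))) alpha F sn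
        (sample X Y n w) (fbar (sample X Y n w))) ->
      {ae P, forall w,
        (cond_expectation P (design X n)
           (fun w' => (empirical_norm2 (design X n w')
              (fun x => fbar (sample X Y n w') x - f0 x))%:E) (design X n w)
         <= (C1 * (1 + sn f0 `^ alpha) * n%:R `^ (- 2 / (2 + beta)))%:E)%E})
    /\
    (forall Q : R, 0 < Q ->
      exists (C2 : R) (n2 : nat),
      forall (d : nat) (F : set ('rV[R]_d -> R)) (sn : ('rV[R]_d -> R) -> R),
      seminormed_function_space F sn ->
      (forall delta : R, 0 < delta ->
        (sup_entropy delta (unit_ball F sn) <= (D * delta `^ (- beta))%:E)%E) ->
      forall (dO : measure_display) (Omega : measurableType dO)
        (P : probability Omega R) (f0 : 'rV[R]_d -> R) (sigma b_eps : R)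
        (X : nat -> {RV P >-> 'rV[R]_d}) (Y eps : nat -> {RV P >-> R}),
      regression_model f0 sigma b_eps X Y eps ->
      b = sigma * b_eps ->
      F f0 ->
      forall (n : nat), (n2 <= n)%N ->
      forall (fbar : n.-tuple ('rV[R]_d * R) -> 'rV[R]_d -> R),
      measurable_estimator fbar ->
      (forall w, penalized_erm (a * n%:R `^ (- 1 / (2 + beta))) alpha F sn
        (sample X Y n w) (fbar (sample X Y n w))) ->
      {ae P, forall w,
        (sup_norm (fun x => fbar (sample X Y n w) x - f0 x)%R <= Q%:E)%E} ->
      (\int[P]_w L2_norm2 (distribution P (X 0%N))
           (fun x => fbar (sample X Y n w) x - f0 x)%R
         <= (C2 * (1 + sn f0 `^ alpha) * n%:R `^ (- 2 / (2 + beta)))%:E)%E).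
Proof.
have [C C0 oracle] :=
  oracle_inequality a beta alpha b D a_gt0 beta_gt0 beta_lt2 alpha_gt D_gt0.
have emp_ge0 n d (x : n.-tuple 'rV[R]_d) f : 0 <= empirical_norm2 x f.
  by rewrite mulr_ge0 ?invr_ge0// sumr_ge0// => i _; rewrite sqr_ge0.
(* The mean of A + W is at most A + 1 <= 2 A for A = 1 + |f0|^alpha. Every n >= 1 is large
   enough. *)
exists (2 * C), 1%N; split.
  move=> d F sn Fsn entF dO Omega P f0 sigma b_eps X Y eps model bE Ff0 n n0 fbar mfbar erm.
  have [W [mW W0 WP Wrisk]] :=
    oracle d F sn Fsn entF dO Omega P f0 sigma b_eps X Y eps model bE Ff0 n n0.
  set nu := n%:R `^ (- 2 / (2 + beta)) in Wrisk *; set A := 1 + sn f0 `^ alpha in Wrisk *.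
  have nu0 : 0 <= nu by exact: powR_ge0.
  have A1 : 1 <= A by rewrite lerDl powR_ge0.
  have A0 : 0 <= A by exact: le_trans A1.
  pose Z w := empirical_norm2 (design X n w) (fun x => fbar (sample X Y n w) x - f0 x).
  apply: (cond_expectation_le P (design X n) Z).
  - by rewrite !mulr_ge0// ltW.
  - exact: measurable_design.
  - by apply: (measurable_empirical_risk P F sn Fsn _ _ _ _ _ _ model) => // w; case: (erm w).
  - by move=> w; exact: emp_ge0.
  move=> B mB.
  have mdB : measurable (design X n @^-1` B).
    by rewrite -[X in measurable X]setTI; exact: measurable_design.
  apply: (@le_trans _ _ ((C * nu * (A + 1))%:E * P (design X n @^-1` B))%E).
    apply: le_trans (integral_affine_le P W (C * nu) A _ mdB mW W0 _ A0 (WP B mB)).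
      apply: ge0_le_integral => //.
      - by move=> w _; rewrite lee_fin; exact: emp_ge0.
      - apply: measurable_funTS; apply/measurable_EFinP.
        by apply: (measurable_empirical_risk P F sn Fsn _ _ _ _ _ _ model) => // w; case: (erm w).
      - apply: measurable_funTS; apply: emeasurable_funM => //.
        exact: emeasurable_funD.
      - move=> w _; apply: le_trans (Wrisk w _ (erm w)).
        by rewrite lee_fin lerDl mulr_ge0 ?sqr_ge0 ?powR_ge0.
    by rewrite mulr_ge0// ltW.
  rewrite lee_wpmul2r// lee_fin.
  have -> : 2 * C * A * nu = C * nu * (A + A) by ring.
  by rewrite ler_wpM2l ?lerD2l// mulr_ge0// ltW.
move=> Q Q0.
have [c1 [c2 [c10 c20 population]]] :=
  population_le_empirical R beta D Q beta_gt0 beta_lt2 D_gt0 Q0.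
(* 8 C comes from the empirical norm. As h^2 = a^2 nu, the penalty part of the oracle inequality
   bounds J^alpha by C / a^2 times A + W, whence the second summand. *)
pose K := 8 * C + c1 * (C / a ^+ 2).
have K0 : 0 < K by rewrite addr_gt0 ?mulr_gt0// invr_gt0 exprn_gt0.
(* 2 K from the mean of A + W, as above, and c2 from the mean of W', at most 1 <= A. *)
exists (2 * K + c2), 1%N.
move=> d F sn Fsn entF dO Omega P f0 sigma b_eps X Y eps model bE Ff0 n n0 fbar mfbar erm supQ.
have [W [mW W0 WP Wrisk]] :=
  oracle d F sn Fsn entF dO Omega P f0 sigma b_eps X Y eps model bE Ff0 n n0.
have [W' [mW' W'0 W'P W'risk]] :=
  population d F sn Fsn entF dO Omega P f0 sigma b_eps X Y eps model n n0.
set nu := n%:R `^ (- 2 / (2 + beta)) in Wrisk W'risk *.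
set A := 1 + sn f0 `^ alpha in Wrisk *.
have nu0 : 0 < nu by rewrite powR_gt0// ltr0n.
have A1 : 1 <= A by rewrite lerDl powR_ge0.
have A0 : 0 <= A by exact: le_trans A1.
have Knu0 : 0 < K * nu by exact: mulr_gt0.
have c2nu0 : 0 < c2 * nu by exact: mulr_gt0.
pose U w := ((K * nu)%:E * (A%:E + W w) + (c2 * nu)%:E * (0%:E + W' w))%E.
have U1 w : (0 <= (K * nu)%:E * (A%:E + W w))%E.
  by rewrite mule_ge0 ?adde_ge0 ?lee_fin// ltW.
have U2 w : (0 <= (c2 * nu)%:E * (0%:E + W' w))%E.
  by rewrite mule_ge0 ?adde_ge0 ?lee_fin// ltW.
have mU1 : measurable_fun setT (fun w => (K * nu)%:E * (A%:E + W w))%E.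
  by apply: emeasurable_funM => //; exact: emeasurable_funD.
have mU2 : measurable_fun setT (fun w => (c2 * nu)%:E * (0%:E + W' w))%E.
  by apply: emeasurable_funM => //; exact: emeasurable_funD.
have WT : (\int[P]_w W w <= P setT)%E.
  by have := WP setT measurableT; rewrite preimage_setT.
have W'T : (\int[P]_w W' w <= P setT)%E by rewrite probability_setT.
apply: (@le_trans _ _ (\int[P]_w U w)%E); last first.
  rewrite (ge0_integralD P measurableT (fun w _ => U1 w) mU1 (fun w _ => U2 w) mU2).
  have I1 := integral_affine_le P W (K * nu) A setT measurableT mW W0 (ltW Knu0) A0 WT.
  have I2 := integral_affine_le P W' (c2 * nu) 0 setT measurableT mW' W'0 (ltW c2nu0) (lexx 0) W'T.
  apply: le_trans (leeD I1 I2) _.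
  rewrite probability_setT !mule1 -EFinD lee_fin add0r mulr1.
  have -> : (2 * K + c2) * A * nu = K * nu * (A + A) + c2 * nu * A by ring.
  by rewrite lerD// ?ler_wpM2l ?(ltW Knu0) ?lerD2l// ler_peMr ?(ltW c2nu0).
apply: ae_le_integral_nonmeasurable.
- move=> w; apply: integral_ge0 => x _; rewrite lee_fin; exact: sqr_ge0.
- exact: emeasurable_funD.
- by move=> w; exact: adde_ge0.
apply: filterS supQ => w supw.
have [Ff _] := erm w; set f := fbar (sample X Y n w) in supw Ff *.
have If0 := seminorm_ge0 Fsn Ff; have I00 := seminorm_ge0 Fsn Ff0.
set J := sn f + sn f0 + 1.
have J1 : 1 <= J by rewrite lerDr addr_ge0.
have gJ : sn (fun x => f x - f0 x) <= J.
  by apply: le_trans (seminormB F sn Fsn _ _ Ff Ff0) _; rewrite lerDl.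
apply: le_trans (W'risk w _ J (fspaceB F sn Fsn _ _ Ff Ff0) J1 gJ (sup_norm_le _ _ supw)) _.
rewrite /U add0e leeD2r//.
have := Wrisk w f (erm w) => /=; rewrite -/J.
set E := empirical_norm2 _ _; set h := a * _.
have hE : h ^+ 2 = a ^+ 2 * nu.
  rewrite /h exprMn -[X in _ * X]powR_mulrn ?powR_ge0// -powRrM; congr (_ * _ `^ _).
  by field; rewrite addrC gt_eqF// addr_gt0.
rewrite hE.
case: (W w) (W0 w) => [t| |//]; last first.
  by move=> _ _; rewrite addey// gt0_muley ?lte_fin// leey.
move=> t0; rewrite -!EFinD -!EFinM !lee_fin => Hr.
have E0 : 0 <= E by exact: emp_ge0.
(* Powers of J increase with the exponent because J >= 1, thanks to the summand 1 in its
   definition. *)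
have JJ : J `^ (2 * beta / (beta + 2)) <= J `^ alpha by rewrite ler_powR// ltW.
have Ja0 : 0 <= J `^ alpha by exact: powR_ge0.
have a2 : 0 < a ^+ 2 by rewrite exprn_gt0.
have Ele : E <= C * nu * (A + t).
  by apply: le_trans Hr; rewrite lerDl !mulr_ge0// ltW.
have Jle : J `^ alpha * nu <= C / a ^+ 2 * (nu * (A + t)).
  rewrite mulrAC ler_pdivlMr//.
  have -> : J `^ alpha * nu * a ^+ 2 = a ^+ 2 * nu * J `^ alpha by ring.
  by apply: le_trans (le_trans _ Hr) _; rewrite ?lerDr// mulrA.
have -> : K * nu * (A + t) = 8 * (C * nu * (A + t)) + c1 * (C / a ^+ 2 * (nu * (A + t))).
  by rewrite /K; ring.
rewrite lerD ?ler_wpM2l// -mulrA ler_wpM2l ?(ltW c10)//.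
by apply: le_trans Jle; rewrite ler_wpM2r// ltW.
Qed.
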